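(* For each odd prime $p$, there exists a non-singular $\{p,p\}$-pattern with exactly $p+1$ vertices.
   Context: A pattern is an ordered pair $(M,G)$, where $M$ is a connected closed surface (compact $2$-manifold without boundary) in some Euclidean space and $G$ is a finite (simple) graph on (i.e. embedded in) $M$ such that each component of $M\setminus G$ is simply connected. The closure of each component of $M\setminus G$ is called a face of $(M,G)$. For a face $F$, the closed path in $G$ consisting of all the edges and vertices in $F$ is called the boundary of $F$. A pattern is non-singular if the boundary of each face is a cycle (a finite connected $2$-regular graph). A pattern $(M,G)$ is a $\{p,q\}$-pattern if each face contains $p$ edges and the degree of each vertex in $G$ is $q$. The vertices of the pattern are the vertices of $G$. *)

(* Defs.v *)
From HB Require Import structures.
From mathcomp Require Import all_boot all_order all_algebra.
From mathcomp Require Import all_classical all_reals all_analysis.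

Set Implicit Arguments.
Unset Strict Implicit.
Unset Printing Implicit Defensive.

Import Order.TTheory GRing.Theory Num.Theory.
Import numFieldNormedType.Exports.

Local Open Scope classical_set_scope.
Local Open Scope ring_scope.

Definition homeomorphic (T U : topologicalType) (A : set T) (B : set U) : Prop :=
  exists (f : T -> U) (g : U -> T),
    [/\ {within A, continuous f} /\ {within B, continuous g},
        f @` A `<=` B,
        g @` B `<=` A,
        (forall x, A x -> g (f x) = x) &
        (forall y, B y -> f (g y) = y)].

Definition path_in (R : realType) (T : topologicalType) (A : set T)
    (x y : T) (c : R -> T) : Prop :=
  [/\ {within `[0, 1]%classic, continuous c}, c @` `[0, 1]%classic `<=` A, c 0 = x & c 1 = y].

(* Homotopy rel endpoints from the loop [c] based at [x] to the constant loop,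
   inside [A]; the first coordinate is the loop parameter, the second one is
   the time. *)
Definition null_homotopic_in (R : realType) (T : topologicalType) (A : set T)
    (x : T) (c : R -> T) : Prop :=
  exists h : R * R -> T,
    [/\ {within `[0, 1]%classic `*` `[0, 1]%classic, continuous h},
        h @` (`[0, 1]%classic `*` `[0, 1]%classic) `<=` A,
        (forall s, 0 <= s <= 1 -> h (s, 0) = c s),
        (forall s, 0 <= s <= 1 -> h (s, 1) = x) &
        (forall t, 0 <= t <= 1 -> h (0, t) = x /\ h (1, t) = x)].

Definition simply_connected (R : realType) (T : topologicalType) (A : set T) :
    Prop :=
  [/\ A !=set0,
      (forall x y, A x -> A y -> exists c : R -> T, path_in A x y c) &
      (forall (x : T) (c : R -> T), path_in A x x c -> null_homotopic_in A x c)].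

(* [A] is a simple arc with ends [x] and [y]. *)
Definition is_arc (R : realType) (T : topologicalType) (A : set T) (x y : T) :
    Prop :=
  exists c : R -> T,
    [/\ {within `[0, 1]%classic, continuous c},
        (forall s t, 0 <= s <= 1 -> 0 <= t <= 1 -> c s = c t -> s = t),
        c @` `[0, 1]%classic = A, c 0 = x & c 1 = y].

(* The Hausdorff and second countability axioms of a manifold hold
   automatically for subspaces of R^n. *)
Definition connected_closed_surface (R : realType) (n : nat)
    (M : set 'rV[R]_n) : Prop :=
  [/\ M !=set0, compact M, connected M &
      forall x, M x -> exists (U : set 'rV[R]_n) (V : set 'rV[R]_2),
        [/\ open U, U x, open V & homeomorphic (M `&` U) V]].

Record sgraph := SGraph {
  vert :> finType;
  adj : rel vert;
  adj_sym : symmetric adj;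
  adj_irr : irreflexive adj
}.

Definition edges (G : sgraph) : {set {set G}} :=
  [set [set e.1; e.2]%SET | e in [set e : G * G | adj e.1 e.2]%SET]%SET.

Definition degree (G : sgraph) (v : G) : nat := #|[set w | adj v w]%SET|.

(* The graph with vertex set [W] and edge set [B] (edges being unordered pairs
   of vertices) is a cycle, i.e. a nonempty connected 2-regular graph. *)
Definition is_cycle (V : finType) (W : {set V}) (B : {set {set V}}) : Prop :=
  [/\ W != finset.set0,
      (forall b, b \in B -> b \subset W),
      (forall v, v \in W -> #|[set b in B | v \in b]%SET| = 2%N) &
      (forall u v, u \in W -> v \in W ->
         connect (fun x y => [set x; y]%SET \in B) u v)].

(* [pos v] is the point representing the vertex [v], and [arc a] the arc
   representing the edge [a]. Values of [arc] at sets of vertices that are not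
   edges are irrelevant. *)
Definition embedded_in (R : realType) (n : nat) (M : set 'rV[R]_n) (G : sgraph)
    (pos : G -> 'rV[R]_n) (arc : {set G} -> set 'rV[R]_n) : Prop :=
  [/\ injective pos,
      (forall v, M (pos v)),
      (forall a, a \in edges G -> arc a `<=` M),
      (forall u v, adj u v ->
         is_arc R (arc [set u; v]%SET) (pos u) (pos v)) &
      (forall a v, a \in edges G -> arc a (pos v) -> v \in a) /\
      (forall a b, a \in edges G -> b \in edges G -> a != b ->
         forall x, arc a x -> arc b x ->
           exists v, [/\ v \in a, v \in b & x = pos v])].

Definition drawing (R : realType) (n : nat) (G : sgraph)
    (pos : G -> 'rV[R]_n) (arc : {set G} -> set 'rV[R]_n) : set 'rV[R]_n :=
  [set x | (exists v, x = pos v) \/ (exists2 a, a \in edges G & arc a x)].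

Definition is_component (T : topologicalType) (A C : set T) : Prop :=
  exists2 x, A x & C = connected_component A x.

Record pattern (R : realType) := Pattern {
  pdim : nat;
  psurface : set 'rV[R]_pdim;
  pgraph : sgraph;
  ppos : pgraph -> 'rV[R]_pdim;
  parc : {set pgraph} -> set 'rV[R]_pdim;
  psurfaceP : connected_closed_surface psurface;
  pembedded : embedded_in psurface ppos parc;
  pcomponentP : forall C,
    is_component (psurface `\` drawing ppos parc) C -> simply_connected R C
}.

Arguments psurface {R} p _.
Arguments ppos {R} p _.
Arguments parc {R} p _.

Section PatternTheory.
Variables (R : realType) (P : pattern R).

(* The closure in R^n agrees with the closure in the surface, which is
   compact. *)
Definition is_face (F : set 'rV[R]_(pdim P)) : Prop :=
  exists2 C, is_component (psurface P `\` drawing (ppos P) (parc P)) C &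
             F = closure C.

Definition face_verts (F : set 'rV[R]_(pdim P)) : {set pgraph P} :=
  [set v | `[< F (ppos P v) >]]%SET.

Definition face_edges (F : set 'rV[R]_(pdim P)) : {set {set pgraph P}} :=
  [set a in edges (pgraph P) | `[< parc P a `<=` F >]]%SET.

Definition non_singular : Prop :=
  forall F, is_face F -> is_cycle (face_verts F) (face_edges F).

Definition is_pq_pattern (p q : nat) : Prop :=
  (forall F, is_face F -> #|face_edges F| = p) /\
  (forall v : pgraph P, degree v = q).

End PatternTheory.

(* Main.v *)
Require Import Defs.
From mathcomp Require Import all_boot all_order all_algebra.
From mathcomp Require Import all_classical all_reals all_analysis.
From mathcomp Require Import ring lra zify.

(** The graph is the complete graph on F_p together with a point oo. Faces are
    indexed by the same set, the face f being a p-cycle through all the vertices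
    except f: the face oo is (0, 1, ..., p - 1), and the face c is
    (oo, c + 1, c - 1, c + 2, c - 2, ..., c + (p - 1) / 2, c - (p - 1) / 2).
    Gluing a cone over each of these cycles gives a simplicial complex, in which
    the link of every vertex is again a cycle; hence it is a closed surface. It is
    realised in the standard simplex spanned by the vertices and the centres of
    the faces. Open stars are charts, because the cone over a cycle is a
    complete fan of the plane; the components of the complement of the graph are
    the open stars of the centres, which are star-shaped. *)

Set Implicit Arguments.
Unset Strict Implicit.
Unset Printing Implicit Defensive.

Import Order.TTheory GRing.Theory Num.Theory.
Import numFieldNormedType.Exports.

Local Open Scope classical_set_scope.
Local Open Scope ring_scope.

(** * Continuity and star-shaped sets *)

Section Topology.
Variable R : realType.

Lemma continuous_rowP (T : topologicalType) n (f : T -> 'rV[R]_n) (x : T) :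
  (forall j, {for x, continuous (fun t => f t 0 j)}) -> {for x, continuous f}.
Proof.
move=> cf A [P nP PA].
have F : nbhs x [set t | forall j, P 0 j (f t 0 j)].
  by apply: filter_forall => j; exact: cf _ _ (nP 0 j).
apply: filterS F => t Pt; apply: PA => i j /=.
by rewrite ord1; exact: Pt.
Qed.

Lemma continuous_sum (T : topologicalType) (J : Type) (r : seq J) (P : pred J)
    (F : J -> T -> R) (x : T) :
  (forall j, P j -> {for x, continuous (F j)}) ->
  {for x, continuous (fun t => \sum_(j <- r | P j) F j t)}.
Proof. by move=> cF; apply: (cvg_big (@add_continuous R)). Qed.

Definition clamp (s : R) : R := Num.max 0 (Num.min 1 s).

Lemma clamp_itv s : 0 <= clamp s <= 1.
Proof. by rewrite /clamp /Num.max /Num.min; repeat case: ifP; lra. Qed.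

Lemma clamp_id s : 0 <= s <= 1 -> clamp s = s.
Proof. by rewrite /clamp /Num.max /Num.min; repeat case: ifP; lra. Qed.

Lemma clamp_interior s : 0 < clamp s < 1 -> 0 < s < 1.
Proof. by rewrite /clamp /Num.max /Num.min; repeat case: ifP; lra. Qed.

Lemma continuous_maxr (T : topologicalType) (f g : T -> R) :
  continuous f -> continuous g -> continuous (fun x => Num.max (f x) (g x)).
Proof. by move=> cf cg x; exact: (continuous_max (cf x) (cg x)). Qed.

Lemma continuous_minr (T : topologicalType) (f g : T -> R) :
  continuous f -> continuous g -> continuous (fun x => Num.min (f x) (g x)).
Proof. by move=> cf cg x; exact: (continuous_min (cf x) (cg x)). Qed.

Lemma continuous_clamp : continuous clamp.
Proof.
apply: continuous_maxr; first exact: cst_continuous.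
by apply: continuous_minr; [exact: cst_continuous|move=> x; exact: cvg_id].
Qed.

Lemma continuous_comp_clamp (T : topologicalType) (c : R -> T) :
  {within `[0, 1], continuous c} -> continuous (c \o clamp).
Proof.
move=> /subspace_continuousP cc s.
have I x : `[0, 1]%classic (clamp x) by rewrite /= in_itv /= clamp_itv.
move=> A /(cc _ (I s)) /= W.
have W' : nbhs s [set t | `[0, 1]%classic (clamp t) -> A (c (clamp t))].
  exact: continuous_clamp W.
suff : nbhs s [set t | A (c (clamp t))] by [].
by apply: filterS W' => t /= h; apply: h; exact: I.
Qed.

(* Weights of a contraction of a loop inside a star-shaped set: the loop first
   becomes constant near both ends of [0, 1] while shrinking to the centre
   (time t <= 1/2), then what remains, a segment run back and forth between the
   base point and the centre, is retracted to the base point. *)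
Lemma loop_contraction_weights : exists u l w : R * R -> R,
  [/\ [/\ continuous u, continuous l & continuous w],
      (forall s t, 0 <= t <= 1 ->
        [/\ 0 <= l (s, t), 0 <= w (s, t), l (s, t) + w (s, t) <= 1 &
            0 < clamp (u (s, t)) < 1 -> l (s, t) = 0 \/ w (s, t) = 0]),
      (forall s, 0 <= s <= 1 -> [/\ u (s, 0) = s, l (s, 0) = 1 & w (s, 0) = 0]),
      (forall s, 0 <= s <= 1 -> l (s, 1) = 0 /\ w (s, 1) = 1) &
      (forall s t, s = 0 \/ s = 1 -> 0 <= t <= 1 ->
        clamp (u (s, t)) = s /\ l (s, t) + w (s, t) = 1)].
Proof.
pose u (q : R * R) : R := q.1 + q.2 * (2 * q.1 - 1).
pose l (q : R * R) : R := Num.max 0 (1 - 2 * q.2).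
pose m (q : R * R) : R := Num.max 0 (2 * q.2 - 1).
pose v (q : R * R) : R :=
  Num.min (1 - (l q + m q)) (2 * Num.max 0 (Num.max (- u q) (u q - 1))).
have c_fst : continuous (fst : R * R -> R) by move=> q; exact: cvg_fst.
have c_snd : continuous (snd : R * R -> R) by move=> q; exact: cvg_snd.
have cM (f g : R * R -> R) : continuous f -> continuous g -> continuous (fun q => f q * g q).
  by move=> cf cg q; apply: cvgM; [exact: cf|exact: cg].
have cD (f g : R * R -> R) : continuous f -> continuous g -> continuous (fun q => f q + g q).
  by move=> cf cg q; apply: cvgD; [exact: cf|exact: cg].
have cN (f : R * R -> R) : continuous f -> continuous (fun q => - f q).
  by move=> cf q; apply: cvgN; exact: cf.
have cc0 (a : R) : continuous (fun q : R * R => a) by exact: cst_continuous.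
have cu : continuous u.
  by apply: (cD) => //; apply: (cM) => //; apply: (cD) => //; exact: cM.
have cl : continuous l.
  by apply: continuous_maxr => //; apply: (cD) => //; apply: (cN); exact: cM.
have cm : continuous m by apply: continuous_maxr => //; apply: (cD) => //; exact: cM.
have cv : continuous v.
  apply: continuous_minr; first by apply: (cD) => //; apply: (cN); exact: cD.
  apply: (cM) => //; apply: continuous_maxr => //; apply: continuous_maxr; first exact: cN.
  exact: cD.
have lm s t : 0 <= t <= 1 -> [/\ 0 <= l (s, t), 0 <= m (s, t),
    l (s, t) + m (s, t) <= 1 & l (s, t) = 0 \/ m (s, t) = 0].
  move=> t01; rewrite /l /m /=; case: (leP t 2^-1) => t2.
    by rewrite max_r ?max_l; [split; try lra; right|lra|lra].
  by rewrite max_l ?max_r; [split; try lra; left|lra|lra].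
have v_itv s t : 0 <= t <= 1 -> 0 <= v (s, t) <= 1 - (l (s, t) + m (s, t)).
  move=> /(lm s)[_ _ lm1 _]; rewrite /v.
  by rewrite ge_min lexx le_min subr_ge0 lm1 pmulr_rge0 // le_max lexx.
exists u, l, (fun q => m q + v q); split.
- by split => //; exact: cD.
- move=> s t t01; have [l0 m0 lm1 lm0] := lm s t t01.
  have := v_itv s t t01 => /andP[v0 v1].
  split => //; [exact: addr_ge0|by rewrite addrA -lerBrDl|].
  move=> /clamp_interior u01; suff -> : v (s, t) = 0 by rewrite addr0.
  rewrite /v; have -> : Num.max 0 (Num.max (- u (s, t)) (u (s, t) - 1)) = 0.
    by apply/max_idPl; rewrite ge_max; case/andP: u01 => ? ?; lra.
  by rewrite mulr0; apply/min_idPr; rewrite subr_ge0.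
- move=> s s01.
  have l1 : l (s, 0) = 1 by rewrite /l /= mulr0 subr0 max_r.
  have m0 : m (s, 0) = 0 by rewrite /m /= mulr0 max_l; lra.
  split => //; first by rewrite /u /= mul0r addr0.
  have := v_itv s 0; rewrite l1 m0 addr0 subrr lexx ler01 add0r => /(_ isT).
  by rewrite -eq_le => /eqP.
- move=> s s01.
  have l0 : l (s, 1) = 0 by rewrite /l /= max_l; lra.
  have m1 : m (s, 1) = 1 by rewrite /m /= max_r; lra.
  split => //; have := v_itv s 1; rewrite l0 m1 add0r subrr lexx ler01 => /(_ isT).
  by rewrite -eq_le => /eqP <-; rewrite addr0.
- move=> s t s_end t01; have [_ _ lm1 _] := lm s t t01.
  have uE : clamp (u (s, t)) = s /\ t <= Num.max 0 (Num.max (- u (s, t)) (u (s, t) - 1)).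
    rewrite /u /clamp; case: s_end => -> /=.
      have -> : 0 + t * (2 * 0 - 1) = - t :> R by ring.
      rewrite opprK !le_max lexx /= orbT; split => //.
      by apply/max_idPl; rewrite ge_min; apply/orP; right; case/andP: t01 => ? ?; lra.
    have -> : 1 + t * (2 * 1 - 1) = 1 + t :> R by ring.
    rewrite min_l ?lerDl; last by case/andP: t01.
    by rewrite max_r // !le_max addrAC subrr add0r lexx !orbT.
  case: uE => -> tv; split => //; rewrite /v min_l ?addrA; first by ring.
  apply: le_trans (_ : 2 * t <= _); last by rewrite ler_pM2l.
  case/andP: t01 => t0 t1; rewrite /l /m /=; case: (leP t 2^-1) => t2.
    by rewrite max_r ?max_l; lra.
  by rewrite max_l ?max_r; lra.
Qed.

Lemma star_shaped_simply_connected n (A : set 'rV[R]_n) (z : 'rV[R]_n) :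
  A z -> (forall x t, A x -> 0 <= t <= 1 -> A (z + t *: (x - z))) ->
  simply_connected R A.
Proof.
move=> Az starA; split; first by exists z.
- move=> x y Ax Ay.
  pose l (t : R) := Num.max 0 (1 - 2 * t); pose m (t : R) := Num.max 0 (2 * t - 1).
  exists (fun t => z + (l t *: (x - z) + m t *: (y - z))); split.
  + have cA (a b : R) : continuous (fun t : R => Num.max 0 (a * t + b)).
      apply: continuous_maxr; first exact: cst_continuous.
      move=> u; apply: cvgD; last exact: cvg_cst.
      by apply: cvgM; [exact: cvg_cst|exact: cvg_id].
    have cl : continuous l.
      suff -> : l = (fun t => Num.max 0 ((- 2) * t + 1)) by exact: cA.
      by apply/funext => u; rewrite /l; congr Num.max; ring.
    apply: continuous_subspaceT => t.
    apply: cvgD; first exact: cvg_cst.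
    by apply: cvgD; apply: cvgZr_tmp; [exact: cl|exact: cA].
  + move=> _ [t /=] + <-; rewrite in_itv /= => t01.
    case: (leP t (1/2)) => ht.
      have -> : m t = 0 by rewrite /m /Num.max; case: ifP; lra.
      rewrite scale0r addr0; apply: starA => //.
      by rewrite /l /Num.max; case: ifP; lra.
    have -> : l t = 0 by rewrite /l /Num.max; case: ifP; lra.
    rewrite scale0r add0r; apply: starA => //.
    by rewrite /m /Num.max; case: ifP; lra.
  + have -> : l 0 = 1 by rewrite /l /Num.max; case: ifP; lra.
    have -> : m 0 = 0 by rewrite /m /Num.max; case: ifP; lra.
    by rewrite scale0r scale1r addr0 addrC subrK.
  + have -> : l 1 = 0 by rewrite /l /Num.max; case: ifP; lra.
    have -> : m 1 = 1 by rewrite /m /Num.max; case: ifP; lra.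
    by rewrite scale0r scale1r add0r addrC subrK.
move=> x c [cc cA c0 c1].
have Ax : A x by rewrite -c0; apply: cA; exists 0 => //=; rewrite in_itv /= lexx ler01.
have Ac s : A (c (clamp s)).
  by apply: cA; exists (clamp s) => //=; rewrite in_itv /= clamp_itv.
have [u [l [w [[cu cl cw] lw tw0 tw1 ends]]]] := loop_contraction_weights.
exists (fun q => z + (l q *: (c (clamp (u q)) - z) + w q *: (x - z))); split.
- apply: continuous_subspaceT => q.
  apply: cvgD; first exact: cvg_cst.
  apply: cvgD; last by apply: cvgZr_tmp; exact: cw.
  apply: cvgZ; first exact: cl.
  apply: cvgB; last exact: cvg_cst.
  exact: (continuous_comp (cu q) (continuous_comp_clamp cc (x:=_))).
- move=> _ [[s t] /= [_] + <-]; rewrite in_itv /= => /(lw s)[l0 w0 lw1 lw0].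
  have [[uE|uE]|u01] : (clamp (u (s, t)) = 0 \/ clamp (u (s, t)) = 1) \/
      0 < clamp (u (s, t)) < 1.
  + have /andP[] := clamp_itv (u (s, t)); rewrite !le_eqVlt.
    move=> /predU1P[<- _|-> /predU1P[->|->]]; first by left; left.
      by left; right.
    by right.
  + by rewrite uE c0 -scalerDl; apply: starA => //; rewrite lw1 addr_ge0.
  + by rewrite uE c1 -scalerDl; apply: starA => //; rewrite lw1 addr_ge0.
  case: (lw0 u01) => E; rewrite E in w0 l0 lw1 *; rewrite scale0r ?add0r ?addr0;
    apply: starA => //; move: lw1; rewrite ?add0r ?addr0 => ->; rewrite andbT //.
- by move=> s s01; have [-> -> ->] := tw0 s s01; rewrite clamp_id // scale0r scale1r addr0 addrC subrK.
- by move=> s s01; have [-> ->] := tw1 s s01; rewrite scale0r scale1r add0r addrC subrK.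
have end_pt s t : 0 <= t <= 1 -> (s = 0 \/ s = 1) ->
    z + (l (s, t) *: (c (clamp (u (s, t))) - z) + w (s, t) *: (x - z)) = x.
  move=> t01 s01; have [-> lw1] := ends s t s01 t01.
  have -> : c s = x by case: s01 => ->.
  by rewrite -scalerDl lw1 scale1r addrC subrK.
by move=> t t01; split; apply: end_pt => //; [left|right].
Qed.

End Topology.

(** * A complete fan of the plane *)

Section Fan.
Variables (R : realType) (n : nat).
Hypothesis n_gt0 : (0 < n)%N.

(* A complete fan of the plane with n + 2 rays, spanned by (0, 1), ..., (n, 1)
   and (-1, -2). The coordinate along the last ray is b; removing it leaves a
   vector of the cone over the segment from (0, 1) to (n, 1), whose other
   coordinates are hat functions. *)
Definition ray_x (i : nat) : R := if (i <= n)%N then i%:R else -1.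
Definition ray_y (i : nat) : R := if (i <= n)%N then 1 else -2.

Definition last_coord (x y : R) : R :=
  Num.max 0 (Num.max (- x) ((x - n%:R * y) / (2 * n%:R - 1))).

Definition hat (i : nat) (x y : R) : R :=
  Num.max 0 (Num.min (x - (i%:R - 1) * y) ((i%:R + 1) * y - x)).

Definition fan_coord (i : nat) (x y : R) : R :=
  let b := last_coord x y in
  if (i <= n)%N then hat i (x + b) (y + 2 * b) else b.

Lemma last_coord_ge0 x y : 0 <= last_coord x y.
Proof. by rewrite le_max lexx. Qed.

Lemma fan_coord_ge0 i x y : 0 <= fan_coord i x y.
Proof. by rewrite /fan_coord /hat; case: ifP; rewrite ?last_coord_ge0 ?le_max ?lexx. Qed.

Lemma hat_in (i j : nat) (a b : R) : 0 <= a -> 0 <= b ->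
  hat j (a * i%:R + b * i.+1%:R) (a + b) = a * (j == i)%:R + b * (j == i.+1)%:R.
Proof.
move=> a0 b0; rewrite /hat -natr1; case: (ltngtP j i) => [ji|ij|->].
- have ji1 : j%:R + 1 <= i%:R :> R by rewrite natr1 ler_nat.
  have -> : (j == i.+1) = false by apply/negP => /eqP; lia.
  rewrite max_l; first by rewrite !mulr0 addr0.
  by rewrite ge_min; apply/orP; right; nra.
- have [->|/negbTE jNi] := eqVneq j i.+1.
    by rewrite mulr0 mulr1 add0r -natr1 min_l ?max_r; lra.
  have ji1 : i%:R + 1 + 1 <= j%:R :> R by rewrite !natr1 ler_nat; lia.
  rewrite max_l; first by rewrite !mulr0 addr0.
  by rewrite ge_min; apply/orP; left; nra.
have -> : (i == i.+1) = false by apply/negP => /eqP; lia.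
by rewrite mulr0 mulr1 addr0 min_r ?max_r; lra.
Qed.

Lemma hat_at (i j : nat) (a : R) : 0 <= a ->
  hat j (a * i%:R) a = a * (j == i)%:R.
Proof. by move=> a0; have := @hat_in i j a 0 a0 (lexx _); rewrite !mul0r !addr0. Qed.

Definition next_ray (i : nat) : nat := if (i <= n)%N then i.+1 else 0.

Lemma fan_coordE (i j : nat) (a b x y : R) : (i <= n.+1)%N -> (j <= n.+1)%N ->
  0 <= a -> 0 <= b ->
  x = a * ray_x i + b * ray_x (next_ray i) ->
  y = a * ray_y i + b * ray_y (next_ray i) ->
  fan_coord j x y = a * (j == i)%:R + b * (j == next_ray i)%:R.
Proof.
move=> iN jN a0 b0; rewrite /next_ray /ray_x /ray_y /fan_coord.
have n1 : 1 <= n%:R :> R by rewrite ler1n.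
have den : 0 < 2 * n%:R - 1 :> R by lra.
case: (ltngtP i n) => [ltin|ltni|->] xE yE.
- rewrite ltin in xE yE.
  have i1n : i%:R + 1 <= n%:R :> R by rewrite natr1 ler_nat.
  have i0 : 0 <= i%:R :> R by [].
  have lc : last_coord x y = 0.
    apply/max_idPl; rewrite ge_max; apply/andP; split; first by rewrite xE -natr1; nra.
    by rewrite pmulr_lle0 ?invr_gt0 // xE yE -natr1; nra.
  rewrite lc mulr0 !addr0; case: ifP => jn.
    by rewrite xE yE !mulr1 hat_in.
  have -> : (j == i) = false by apply/negP => /eqP; lia.
  have -> : (j == i.+1) = false by apply/negP => /eqP; lia.
  by rewrite !mulr0 addr0.
- have iE : i = n.+1 by lia.
  rewrite leq0n in xE yE.
  have lc : last_coord x y = a.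
    rewrite /last_coord (max_l (_ : _ <= - x)) ?max_r; first by rewrite xE; ring.
      by rewrite xE; lra.
    by rewrite ler_pdivrMr // xE yE; nra.
  rewrite lc; case: ifP => jn.
    have -> : x + a = b * 0%:R by rewrite xE; ring.
    have -> : y + 2 * a = b by rewrite yE; ring.
    rewrite hat_at //; have -> : (j == i) = false by apply/negP => /eqP; lia.
    by rewrite mulr0 add0r.
  have -> : (j == i) = true by apply/eqP; lia.
  have -> : (j == 0)%N = false by apply/negP => /eqP; lia.
  by rewrite mulr0 addr0 mulr1.
rewrite ltnn in xE yE.
have lc : last_coord x y = b.
  have E : (x - n%:R * y) / (2 * n%:R - 1) = b.
    by apply: (canLR (mulfK _)); [rewrite gt_eqF|rewrite xE yE; ring].
  by rewrite /last_coord E (max_r (_ : - x <= _)) ?max_r // xE; nra.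
rewrite lc; case: ifP => jn.
  have -> : x + b = a * n%:R by rewrite xE; ring.
  have -> : y + 2 * b = a by rewrite yE; ring.
  rewrite hat_at //; have -> : (j == n.+1) = false by apply/negP => /eqP; lia.
  by rewrite mulr0 addr0.
have -> : (j == n.+1) = true by apply/eqP; lia.
have -> : (j == n) = false by apply/negP => /eqP; lia.
by rewrite mulr0 add0r mulr1.
Qed.

Lemma segment_cover (x y : R) : 0 <= y -> 0 <= x <= n%:R * y ->
  exists2 i, (i < n)%N & i%:R * y <= x <= i.+1%:R * y.
Proof.
move=> y0; elim: n n_gt0 => // k IHk _ /andP[x0 xk].
have [xk'|xk'] := leP x (k%:R * y); last by exists k => //; rewrite (ltW xk').
case: k => [|k] in IHk xk xk' *; first by exists 0%N => //; rewrite mul0r x0 xk.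
by have [|i ik iP] := IHk isT; [rewrite x0|exists i => //; lia].
Qed.

Lemma fan_cover (x y : R) : exists i a b,
  [/\ (i <= n.+1)%N, 0 <= a, 0 <= b,
      x = a * ray_x i + b * ray_x (next_ray i) &
      y = a * ray_y i + b * ray_y (next_ray i)].
Proof.
rewrite /next_ray /ray_x /ray_y.
have n1 : 1 <= n%:R :> R by rewrite ler1n.
have den : 0 < 2 * n%:R - 1 :> R by lra.
pose b := (x - n%:R * y) / (2 * n%:R - 1).
have bE : b * (2 * n%:R - 1) = x - n%:R * y by rewrite divfK // gt_eqF.
have [bx|xb] := leP b (- x).
  have [x0|x0] := leP x 0.
    exists n.+1, (- x), (y - 2 * x); rewrite ltnn leq0n.
    by split => //; [lra|nra|ring|ring].
  have b0 : b <= 0 by lra.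
  have xny : x <= n%:R * y by rewrite -subr_le0 -bE; nra.
  have y0 : 0 <= y by nra.
  have [|i ilt /andP[ix xi]] := @segment_cover x y y0; first by rewrite (ltW x0).
  exists i, (i.+1%:R * y - x), (x - i%:R * y); rewrite (leqW (ltnW ilt)) (ltnW ilt) ilt.
  by split => //; rewrite ?subr_ge0 // -natr1; ring.
have [b0|b0] := leP 0 b.
  exists n, (y + 2 * b), b; rewrite leqnn ltnn leqW //; split => //; last by ring.
    have : 0 <= n%:R * (y + 2 * b) by nra.
    by rewrite pmulr_rge0 // ltr0n.
  by apply: (@addIr _ (- (n%:R * y))); rewrite -bE; ring.
have xny : x <= n%:R * y by rewrite -subr_le0 -bE; nra.
have x0 : 0 <= x by lra.
have y0 : 0 <= y by nra.
have [|i ilt /andP[ix xi]] := @segment_cover x y y0; first by rewrite x0.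
exists i, (i.+1%:R * y - x), (x - i%:R * y); rewrite (leqW (ltnW ilt)) (ltnW ilt) ilt.
by split => //; rewrite ?subr_ge0 // -natr1; ring.
Qed.

Lemma fan_coord_continuous (T : topologicalType) (f g : T -> R) i :
  continuous f -> continuous g -> continuous (fun t => fan_coord i (f t) (g t)).
Proof.
move=> cf cg; pose b t := last_coord (f t) (g t).
have cM (h k : T -> R) : continuous h -> continuous k -> continuous (fun t => h t * k t).
  by move=> ch ck t; apply: cvgM; [exact: ch|exact: ck].
have cD (h k : T -> R) : continuous h -> continuous k -> continuous (fun t => h t + k t).
  by move=> ch ck t; apply: cvgD; [exact: ch|exact: ck].
have cB (h k : T -> R) : continuous h -> continuous k -> continuous (fun t => h t - k t).
  by move=> ch ck t; apply: cvgB; [exact: ch|exact: ck].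
have cC (a : R) : continuous (fun _ : T => a) by exact: cst_continuous.
have cb : continuous b.
  apply: continuous_maxr => //; apply: continuous_maxr; first by move=> t; apply: cvgN; exact: cf.
  by apply: (cM) => //; apply: (cB) => //; exact: cM.
rewrite /fan_coord; case: (i <= n)%N => //; rewrite /hat.
apply: continuous_maxr => //; apply: continuous_minr.
  by apply: (cB); [exact: cD|apply: (cM) => //; apply: (cD) => //; exact: cM].
by apply: (cB); [apply: (cM) => //; apply: (cD) => //; exact: cM|exact: cD].
Qed.

End Fan.

(** * Simplicial complexes in the standard simplex *)

Section Complex.
Variables (R : realType) (I : finType).
Implicit Types (x y : 'rV[R]_#|I|) (s t : {set I}) (K : {set {set I}}) (c i j : I).

Definition coor x i : R := x 0 (enum_rank i).

Definition row_of (f : I -> R) : 'rV[R]_#|I| := \row_j f (enum_val j).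

Definition unit_pt i : 'rV[R]_#|I| := row_of (fun j => (j == i)%:R).

Lemma coor_row_of f i : coor (row_of f) i = f i.
Proof. by rewrite /coor mxE enum_rankK. Qed.

Lemma coor_unit_pt i j : coor (unit_pt i) j = (j == i)%:R.
Proof. exact: coor_row_of. Qed.

Lemma coorP x y : (forall i, coor x i = coor y i) -> x = y.
Proof. by move=> xy; apply/rowP => j; have := xy (enum_val j); rewrite /coor enum_valK. Qed.

Lemma coor_segment x y (r : R) i :
  coor (x + r *: (y - x)) i = coor x i + r * (coor y i - coor x i).
Proof. by rewrite /coor !mxE. Qed.

Lemma coor_continuous i : continuous (coor ^~ i).
Proof. exact: coord_continuous. Qed.

Lemma open_coor_gt0 i : open [set x | 0 < coor x i].
Proof.
have O : open [set z : R | 0 < z] by exact: open_gt.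
have cc : {in (coor ^~ i) @^-1` [set z : R | 0 < z], continuous (coor ^~ i)}.
  by move=> x _; exact: coor_continuous.
exact: open_comp cc O.
Qed.

Lemma continuous_row_of (T : topologicalType) (f : T -> I -> R) (a : T) :
  (forall i, {for a, continuous (f ^~ i)}) -> {for a, continuous (fun u => row_of (f u))}.
Proof.
move=> cf; apply: continuous_rowP => j.
suff -> : (fun u => row_of (f u) 0 j) = f ^~ (enum_val j) by exact: cf.
by apply/funext => u; rewrite mxE.
Qed.

Lemma continuous_segment x y : continuous (fun r : R => x + r *: (y - x)).
Proof.
by move=> r; apply: cvgD; [exact: cvg_cst|apply: cvgZr_tmp; exact: cvg_id].
Qed.

Lemma coor_sum_continuous (P : pred I) : continuous (fun x => \sum_(i | P i) coor x i).
Proof.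
by move=> x; apply: continuous_sum => i _; exact: coor_continuous.
Qed.

Definition simplex s : set 'rV[R]_#|I| :=
  [set x | [/\ forall i, 0 <= coor x i, \sum_i coor x i = 1 &
               forall i, i \notin s -> coor x i = 0]].

Definition polyhedron K : set 'rV[R]_#|I| := [set x | exists2 s, s \in K & simplex s x].

Lemma simplexS s t : s \subset t -> simplex s `<=` simplex t.
Proof.
move=> /fintype.subsetP st x [x0 x1 xs]; split => // i it; apply: xs.
by apply: contra it; exact: st.
Qed.

Lemma simplexI s t x : simplex s x -> simplex t x -> simplex (s :&: t)%SET x.
Proof.
move=> [x0 x1 xs] [_ _ xt]; split => // i; rewrite inE negb_and => /orP[]; auto.
Qed.

Lemma coor_gt0_in s x i : simplex s x -> 0 < coor x i -> i \in s.
Proof. by move=> [_ _ xs]; apply: contraTT => /xs ->; rewrite ltxx. Qed.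

Lemma simplex_coor_sum s x : simplex s x -> \sum_(i in s) coor x i = 1.
Proof.
move=> [_ <- xs]; rewrite [RHS](bigID (mem s)) /= [X in _ = _ + X]big1 ?addr0 //.
Qed.

Lemma simplex1 i x : simplex [set i]%SET x -> x = unit_pt i.
Proof.
move=> xi; have := simplex_coor_sum xi; rewrite big_set1 => xi1.
apply: coorP => j; rewrite coor_unit_pt; have [->//|ji] := eqVneq j i.
by have [_ _ ->] := xi; rewrite // inE.
Qed.

Lemma simplex_neq0 s x : simplex s x -> exists2 i, i \in s & 0 < coor x i.
Proof.
move=> xs; have [/existsP[i /andP[si xi]]|/existsPn no] :=
  boolP [exists i, (i \in s) && (0 < coor x i)]; first by exists i.
have := simplex_coor_sum xs; rewrite big1 => [/eqP|i si]; first by rewrite eq_sym oner_eq0.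
have := no i; rewrite si /= -leNgt => xi0.
by apply/eqP; rewrite eq_le xi0; case: xs => ->.
Qed.

Lemma unit_pt_in s i : i \in s -> simplex s (unit_pt i).
Proof.
move=> is_; split => [j||j js]; rewrite ?coor_unit_pt //.
  by rewrite (bigD1 i) //= coor_unit_pt eqxx big1 ?addr0 // => j /negbTE; rewrite coor_unit_pt => ->.
by case: eqP => // ji; rewrite ji is_ in js.
Qed.

Lemma simplex_convex s x y (r : R) : simplex s x -> simplex s y -> 0 <= r <= 1 ->
  simplex s (x + r *: (y - x)).
Proof.
move=> [x0 x1 xs] [y0 y1 ys] r01; split => [i||i is_]; rewrite ?coor_segment.
- by have := x0 i; have := y0 i; nra.
- under eq_bigr do rewrite coor_segment.
  by rewrite big_split /= -mulr_sumr sumrB x1 y1 subrr mulr0 addr0.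
by rewrite xs ?ys // subrr mulr0 addr0.
Qed.

Lemma simplex_closed s : closed (simplex s).
Proof.
have -> : simplex s =
    (\bigcap_(i in [set: I]) ((coor ^~ i) @^-1` [set z | 0 <= z]))
    `&` ((fun x => \sum_(i | true) coor x i) @^-1` [set 1]
    `&` \bigcap_(i in [set i | i \notin s]) ((coor ^~ i) @^-1` [set 0])).
  apply/seteqP; split => [x [x0 x1 xs]|x [x0 [x1 xs]]].
    by split; [move=> i _; exact: x0|split].
  by split; [move=> i; exact: (x0 i Logic.I)|exact: x1|move=> i; exact: xs].
apply: closedI.
  apply: closed_bigI => i _; apply: preimage_closed; last exact: closed_ge.
  by move=> x _; exact: coor_continuous.
apply: closedI.
  apply: preimage_closed; last exact: closed_eq.
  by move=> x _; exact: coor_sum_continuous.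
apply: closed_bigI => i _; apply: preimage_closed; last exact: closed_eq.
by move=> x _; exact: coor_continuous.
Qed.

Lemma simplex_compact s : compact (simplex s).
Proof.
have box : compact [set x : 'rV[R]_#|I| | forall k, `[0, 1]%classic (x ord0 k)].
  by apply: (@rV_compact R _ (fun _ => `[0, 1]%classic)) => _; exact: segment_compact.
apply: (subclosed_compact (@simplex_closed s) box).
move=> x [x0 x1 _] j /=; rewrite in_itv /=.
have -> : x ord0 j = coor x (enum_val j) by rewrite /coor enum_valK.
rewrite x0 /= -x1 (bigD1 (enum_val j)) //= lerDl.
by apply: sumr_ge0 => i _; exact: x0.
Qed.

Lemma polyhedronE K : polyhedron K = \big[setU/set0]_(s <- enum K) simplex s.
Proof.
rewrite -bigcup_seq; apply/seteqP; split => x [s sK xs]; exists s => //=.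
  by rewrite mem_enum.
by move: sK; rewrite /= mem_enum.
Qed.

Lemma polyhedron_closed K : closed (polyhedron K).
Proof. by rewrite polyhedronE; apply: closed_bigsetU => s _; exact: simplex_closed. Qed.

Lemma polyhedron_compact K : compact (polyhedron K).
Proof. by rewrite polyhedronE; apply: bigsetU_compact => s _; exact: simplex_compact. Qed.

Lemma star_shaped_connected (A : set 'rV[R]_#|I|) z :
  (forall x (r : R), A x -> 0 <= r <= 1 -> A (z + r *: (x - z))) -> connected A.
Proof.
move=> starA; pose S x := (fun r : R => z + r *: (x - z)) @` `[0, 1]%classic.
have SE x : S x x by exists 1; rewrite /= ?in_itv /= ?lexx ?ler01 // scale1r addrC subrK.
have -> : A = \bigcup_(x in A) S x.
  apply/seteqP; split => [x Ax|x [y Ay [r /= + <-]]]; first by exists x.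
  by rewrite in_itv /=; exact: starA.
apply: bigcup_connected.
  by exists z => x Ax; exists 0; rewrite /= ?in_itv /= ?lexx ?ler01 // scale0r addr0.
move=> x _; apply: connected_continuous_connected; first exact: segment_connected.
by apply: continuous_subspaceT; exact: continuous_segment.
Qed.

Lemma simplex_connected s : connected (simplex s).
Proof.
have [/eqP s0|/set0Pn[i is_]] := boolP (s == finset.set0).
  suff -> : simplex s = set0 by exact: connected0.
  rewrite -subset0 s0 => x xs; have [i] := simplex_neq0 xs; by rewrite inE.
apply: (@star_shaped_connected _ (unit_pt i)) => x r xs.
by apply: simplex_convex => //; exact: unit_pt_in.
Qed.

Lemma arc_simplex2 i j : i != j -> is_arc R (simplex [set i; j]%SET) (unit_pt i) (unit_pt j).
Proof.
move=> ij; exists (fun r => unit_pt i + r *: (unit_pt j - unit_pt i)); split.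
- by apply: continuous_subspaceT; exact: continuous_segment.
- move=> a b _ _ /(congr1 (coor ^~ j)); rewrite /= !coor_segment !coor_unit_pt eqxx.
  by rewrite eq_sym (negbTE ij) !add0r subr0 !mulr1.
- apply/seteqP; split => [_ [r /= + <-]|x xs].
    by rewrite in_itv /= => r01; apply: simplex_convex => //; apply: unit_pt_in; rewrite !inE eqxx ?orbT.
  have := simplex_coor_sum xs; rewrite big_setU1 ?inE // big_set1 => xE.
  have xi : coor x i = 1 - coor x j by rewrite -xE /= addrK.
  have [x0 _ xij] := xs.
  exists (coor x j); first by rewrite /= in_itv /= x0 -xE lerDr x0.
  apply: coorP => k; rewrite coor_segment !coor_unit_pt.
  have [->|ki] := eqVneq k i; first by rewrite (negbTE ij) xi /=; ring.
  have [->|kj] := eqVneq k j; first by rewrite /=; ring.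
  by rewrite (xij k) ?inE ?negb_or ?ki ?kj //=; ring.
- by rewrite scale0r addr0.
- by rewrite scale1r addrC subrK.
Qed.

Definition open_star K c : set 'rV[R]_#|I| := [set x | polyhedron K x /\ 0 < coor x c].

Definition closed_star K c : set 'rV[R]_#|I| :=
  [set x | exists s, [/\ s \in K, c \in s & simplex s x]].

Lemma closed_star_closed K c : closed (closed_star K c).
Proof.
have -> : closed_star K c = polyhedron [set s in K | c \in s]%SET.
  apply/seteqP; split => x; first by move=> [s [sK cs xs]]; exists s; rewrite // inE sK.
  by move=> [s]; rewrite inE => /andP[sK cs] xs; exists s.
exact: polyhedron_closed.
Qed.

Lemma open_star_segment K c x (r : R) : closed_star K c x -> 0 < r <= 1 ->
  open_star K c (x + r *: (unit_pt c - x)).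
Proof.
move=> [s [sK cs xs]] r01; split.
  by exists s => //; apply: simplex_convex => //; [exact: unit_pt_in|lra].
rewrite coor_segment coor_unit_pt eqxx /=; have [x0 _ _] := xs; have := x0 c.
have [rlt1|r1] := ltP r 1; first by nra.
have -> : r = 1 by lra.
by rewrite mul1r addrC subrK.
Qed.

Lemma closure_open_star K c : closure (open_star K c) = closed_star K c.
Proof.
apply/seteqP; split => [x|x xs].
  move=> xc; apply: (closed_star_closed (c := c)); apply: closureS xc.
  by move=> y [[s sK ys] yc]; exists s; split => //; exact: coor_gt0_in yc.
move=> B xB; have : nbhs (0 : R) [set r : R | B (x + r *: (unit_pt c - x))].
  by apply: (continuous_segment (x := x) (y := unit_pt c)); rewrite scale0r addr0.
move=> /nbhs_ballP[e /= e0 eB]; pose r := Num.min 1 (e / 2).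
have r01 : 0 < r <= 1 by rewrite ge_min lexx lt_min ltr01 divr_gt0.
exists (x + r *: (unit_pt c - x)); split; first exact: open_star_segment.
apply: eB; rewrite /ball /= sub0r normrN gtr0_norm; last by case/andP: r01.
by rewrite gt_min; apply/orP; right; rewrite ltr_pdivrMr // ltr_pMr // ltr1n.
Qed.

Lemma open_star_closed_star K c : open_star K c `<=` closed_star K c.
Proof. by rewrite -closure_open_star; exact: subset_closure. Qed.

Lemma open_star_star_shaped K c x (r : R) : open_star K c x -> 0 <= r <= 1 ->
  open_star K c (unit_pt c + r *: (x - unit_pt c)).
Proof.
move=> xc r01; have [r1|rN1] := eqVneq r 1.
  by rewrite r1 scale1r addrC subrK.
have -> : unit_pt c + r *: (x - unit_pt c) = x + (1 - r) *: (unit_pt c - x).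
  by apply: coorP => i; rewrite !coor_segment; ring.
apply: open_star_segment; first exact: open_star_closed_star.
by case/andP: r01 => r0; rewrite le_eqVlt (negbTE rN1) /= => r1; lra.
Qed.

Lemma open_star_center K c s : s \in K -> c \in s -> open_star K c (unit_pt c).
Proof.
move=> sK cs; split; first by exists s => //; exact: unit_pt_in.
by rewrite coor_unit_pt eqxx.
Qed.

Lemma open_star_simply_connected K c s : s \in K -> c \in s ->
  simply_connected R (open_star K c).
Proof.
move=> sK cs; apply: (@star_shaped_simply_connected _ _ _ (unit_pt c)).
  exact: open_star_center sK cs.
by move=> x r; exact: open_star_star_shaped.
Qed.

Lemma open_star_connected K c : connected (open_star K c).
Proof. by apply: (@star_shaped_connected _ (unit_pt c)) => x r; exact: open_star_star_shaped. Qed.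

End Complex.

(** * Charts and components *)

Section Chart.
Variables (R : realType) (I : finType) (K : {set {set I}}) (c : I).
Variables (n : nat) (w : nat -> I).
Hypothesis n_gt0 : (0 < n)%N.
Hypothesis w_inj : forall i j, (i <= n.+1)%N -> (j <= n.+1)%N -> w i = w j -> i = j.
Hypothesis w_neq : forall i, (i <= n.+1)%N -> w i != c.
Hypothesis w_star : forall i, (i <= n.+1)%N -> [set c; w i; w (next_ray n i)]%SET \in K.
Hypothesis starE : forall s, s \in K -> c \in s ->
  exists2 i, (i <= n.+1)%N & s = [set c; w i; w (next_ray n i)]%SET.

Let next_le i : (next_ray n i <= n.+1)%N.
Proof. by rewrite /next_ray; case: ifP; lia. Qed.

Let next_neq i : next_ray n i != i.
Proof. by rewrite /next_ray; case: ifP; lia. Qed.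

Definition ray (k : 'I_2) i : R := if k == 0 then ray_x R n i else ray_y R n i.

Definition star_map (x : 'rV[R]_#|I|) : 'rV[R]_2 :=
  \row_k \sum_(i < n.+2) coor x (w i) / coor x c * ray k i.

Definition star_coor (y : 'rV[R]_2) (j : I) : R :=
  if j == c then 1 else \sum_(i < n.+2 | w i == j) fan_coord n i (y 0 0) (y 0 1).

Definition star_inv (y : 'rV[R]_2) : 'rV[R]_#|I| :=
  row_of (fun j => star_coor y j / \sum_k star_coor y k).

Lemma star_coor_ge0 y j : 0 <= star_coor y j.
Proof.
by rewrite /star_coor; case: ifP => // _; apply: sumr_ge0 => i _; exact: fan_coord_ge0.
Qed.

Lemma sum_star_coor_gt0 y : 0 < \sum_k star_coor y k.
Proof.
rewrite (bigD1 c) //= {1}/star_coor eqxx ltr_pwDl //.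
by apply: sumr_ge0 => i _; exact: star_coor_ge0.
Qed.

Lemma star_coor_link y i : (i <= n.+1)%N ->
  star_coor y (w i) = fan_coord n i (y 0 0) (y 0 1).
Proof.
move=> iN; rewrite /star_coor (negbTE (w_neq iN)) (big_pred1 (Ordinal (iN : (i < n.+2)%N))) //.
move=> k /=; apply/eqP/eqP => [|->//].
by move=> wk; apply: val_inj => /=; apply: w_inj wk => //; rewrite -ltnS.
Qed.

Lemma star_coor_out y j : j != c -> (forall i, (i <= n.+1)%N -> w i != j) -> star_coor y j = 0.
Proof.
move=> jc wj; rewrite /star_coor (negbTE jc) big1 // => i /eqP wi.
by have := wj i; rewrite wi eqxx -ltnS ltn_ord => /(_ isT).
Qed.

Lemma sum_two_rays (a b : R) (F : nat -> R) i : (i <= n.+1)%N ->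
  \sum_(k < n.+2) (a * (nat_of_ord k == i)%:R + b * (nat_of_ord k == next_ray n i)%:R) * F k
  = a * F i + b * F (next_ray n i).
Proof.
move=> iN; under eq_bigr do rewrite mulrDl; rewrite big_split /=.
have one (e : R) (j : nat) : (j <= n.+1)%N ->
    \sum_(k < n.+2) e * (nat_of_ord k == j)%:R * F k = e * F j.
  move=> jN; rewrite (bigD1 (Ordinal (jN : (j < n.+2)%N))) //= eqxx mulr1 big1 ?addr0 //.
  move=> k kj; have -> : (nat_of_ord k == j) = false.
    by apply: contraNF kj => /eqP kj; apply/eqP/val_inj.
  by rewrite mulr0 mul0r.
by rewrite !one.
Qed.

Lemma rowE2 (y z : 'rV[R]_2) : y 0 0 = z 0 0 -> y 0 1 = z 0 1 -> y = z.
Proof.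
move=> y0 y1; apply/rowP => k; have [->|->] // : k = 0 \/ k = 1.
by case: k => [[|[|//]] kP]; [left|right]; exact: val_inj.
Qed.

Lemma star_map_ratio x (a b : R) i : (i <= n.+1)%N ->
  (forall k, (k <= n.+1)%N ->
     coor x (w k) / coor x c = a * (k == i)%:R + b * (k == next_ray n i)%:R) ->
  (star_map x) 0 0 = a * ray_x R n i + b * ray_x R n (next_ray n i) /\
  (star_map x) 0 1 = a * ray_y R n i + b * ray_y R n (next_ray n i).
Proof.
move=> iN xE; rewrite !mxE -(sum_two_rays a b (ray_x R n)) // -(sum_two_rays a b (ray_y R n)) //.
by split; apply: eq_bigr => k _; rewrite xE // -ltnS.
Qed.

Lemma star_inv_cone (y : 'rV[R]_2) : exists i a b,
  [/\ (i <= n.+1)%N,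
      y 0 0 = a * ray_x R n i + b * ray_x R n (next_ray n i),
      y 0 1 = a * ray_y R n i + b * ray_y R n (next_ray n i) &
      forall k, (k <= n.+1)%N ->
        star_coor y (w k) = a * (k == i)%:R + b * (k == next_ray n i)%:R].
Proof.
have [i [a [b [iN a0 b0 xE yE]]]] := fan_cover n_gt0 (y 0 0) (y 0 1).
exists i, a, b; split => // k kN; rewrite star_coor_link //.
exact: fan_coordE xE yE.
Qed.

Lemma star_map_cone (x : 'rV[R]_#|I|) : open_star K c x -> exists i a b,
  [/\ (i <= n.+1)%N, 0 <= a, 0 <= b,
      (forall j, j != c -> (forall k, (k <= n.+1)%N -> w k != j) -> coor x j = 0) &
      forall k, (k <= n.+1)%N ->
        coor x (w k) / coor x c = a * (k == i)%:R + b * (k == next_ray n i)%:R].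
Proof.
move=> [[s sK xs] xc]; have [i iN sE] := starE sK (coor_gt0_in xs xc).
have [x0 _ xout] := xs.
exists i, (coor x (w i) / coor x c), (coor x (w (next_ray n i)) / coor x c).
split => //; [by rewrite divr_ge0|by rewrite divr_ge0| |].
  move=> j jc wj; apply: xout; rewrite sE !inE !negb_or jc /=.
  by rewrite ![j == _]eq_sym !wj.
move=> k kN; have [->|ki] := eqVneq k i.
  by rewrite eq_sym (negbTE (next_neq i)) mulr0 addr0 mulr1.
have [->|kj] := eqVneq k (next_ray n i); first by rewrite mulr0 add0r mulr1.
rewrite xout ?mul0r ?mulr0 ?addr0 // sE !inE !negb_or w_neq //=.
by apply/andP; split; [apply: contra ki|apply: contra kj] => /eqP /w_inj ->.
Qed.

Lemma star_invK (x : 'rV[R]_#|I|) : open_star K c x -> star_inv (star_map x) = x.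
Proof.
move=> xst; have [i [a [b [iN a0 b0 xout xE]]]] := star_map_cone xst.
have [[s sK xs] xc] := xst; have [_ x1 _] := xs.
have [fx fy] := star_map_ratio iN xE.
have scE j : star_coor (star_map x) j = coor x j / coor x c.
  have [->|jc] := eqVneq j c; first by rewrite /star_coor eqxx divff // gt_eqF.
  have [/existsP[k /eqP wk]|/existsPn no] := boolP [exists k : 'I_n.+2, w k == j].
    have kN : (k <= n.+1)%N by rewrite -ltnS.
    by rewrite -wk star_coor_link // xE //; exact: fan_coordE fx fy.
  have wj k : (k <= n.+1)%N -> w k != j by move=> kN; exact: no (Ordinal (kN : (k < n.+2)%N)).
  by rewrite star_coor_out // xout // mul0r.
apply: coorP => j; rewrite coor_row_of scE; under eq_bigr do rewrite scE.
by rewrite -mulr_suml x1 mul1r invrK divfK // gt_eqF.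
Qed.

Lemma star_mapK y : star_map (star_inv y) = y.
Proof.
have [i [a [b [iN yx yy yE]]]] := star_inv_cone y.
have s0 : \sum_k star_coor y k != 0 by rewrite gt_eqF // sum_star_coor_gt0.
have [|fx fy] := @star_map_ratio (star_inv y) a b i iN; last first.
  by apply: rowE2; rewrite ?fx ?fy.
move=> k kN; rewrite !coor_row_of -yE // {3}/star_coor eqxx.
by rewrite mul1r invrK divfK.
Qed.

Lemma star_inv_open_star y : open_star K c (star_inv y).
Proof.
have [i [a [b [iN yx yy yE]]]] := star_inv_cone y.
have s0 := sum_star_coor_gt0 y.
split; last by rewrite coor_row_of divr_gt0 // /star_coor eqxx.
exists [set c; w i; w (next_ray n i)]%SET; first exact: w_star.
split=> [j||j]; first by rewrite coor_row_of divr_ge0 ?star_coor_ge0 // ltW.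
  by under eq_bigr do rewrite coor_row_of; rewrite -mulr_suml divff // gt_eqF.
rewrite !inE !negb_or -andbA => /and3P[jc ji jn]; rewrite coor_row_of.
suff -> : star_coor y j = 0 by rewrite mul0r.
have [/existsP[k /eqP wk]|/existsPn no] := boolP [exists k : 'I_n.+2, w k == j].
  have kN : (k <= n.+1)%N by rewrite -ltnS.
  rewrite -wk yE //; rewrite -wk in ji jn.
  have -> : (nat_of_ord k == i) = false by apply: contraNF ji => /eqP ->.
  have -> : (nat_of_ord k == next_ray n i) = false by apply: contraNF jn => /eqP ->.
  by rewrite !mulr0 addr0.
by apply: star_coor_out => // k kN; exact: no (Ordinal (kN : (k < n.+2)%N)).
Qed.

Lemma star_map_continuous x : 0 < coor x c -> {for x, continuous star_map}.
Proof.
move=> xc; apply: continuous_rowP => k.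
have -> : (fun t => star_map t 0 k) =
    (fun t => \sum_(i < n.+2) coor t (w i) / coor t c * ray k i).
  by apply/funext => t; rewrite mxE.
apply: continuous_sum => i _; apply: continuousM; last exact: cst_continuous.
apply: continuousM; first exact: coor_continuous.
by apply: continuousV; [rewrite gt_eqF|exact: coor_continuous].
Qed.

Lemma star_inv_continuous : continuous star_inv.
Proof.
have cs j : continuous (star_coor ^~ j).
  move=> y; rewrite /star_coor; case: (j == c); first exact: cst_continuous.
  apply: continuous_sum => i _.
  by apply: (@fan_coord_continuous _ _ _ (fun y : 'rV[R]_2 => y 0 0) (fun y : 'rV[R]_2 => y 0 1));
    exact: coord_continuous.
move=> y; apply: continuous_row_of => j; apply: continuousM; first exact: cs.
apply: continuousV; first by rewrite gt_eqF // sum_star_coor_gt0.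
by apply: continuous_sum => k _; exact: cs.
Qed.

Lemma open_star_chart : exists (U : set 'rV[R]_#|I|) (V : set 'rV[R]_2),
  [/\ open U, (forall x, 0 < coor x c -> U x), open V & homeomorphic (polyhedron K `&` U) V].
Proof.
exists [set x | 0 < coor x c], setT; split => //; last 1 first.
- exists star_map, star_inv; split.
  + split; last exact: continuous_subspaceT star_inv_continuous.
    apply/subspace_continuousP => x [_ xc].
    apply: cvg_within_filter; exact: star_map_continuous.
  + by [].
  + by move=> _ [y _ <-]; exact: star_inv_open_star.
  + by move=> x; exact: star_invK.
  + by move=> y _; exact: star_mapK.
- exact: open_coor_gt0.
- exact: openT.
Qed.

End Chart.

Section Components.
Variables (R : realType) (I : finType) (K : {set {set I}}).

Lemma polyhedron_connected (v : I) :
  (forall s, s \in K -> exists i t, [/\ i \in s, t \in K, i \in t & v \in t]) ->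
  connected (@polyhedron R I K).
Proof.
move=> hub.
have -> : @polyhedron R I K = \bigcup_(st in [set st : {set I} * {set I} |
    [/\ st.1 \in K, st.2 \in K, v \in st.2 & st.1 :&: st.2 != finset.set0]])
    (@simplex R I st.1 `|` @simplex R I st.2).
  apply/seteqP; split => x.
    move=> [s sK xs]; have [i [t [is_ tK it vt]]] := hub s sK.
    by exists (s, t); [split => //; apply/set0Pn; exists i; rewrite inE is_|left].
  by move=> [[s t] /= [sK tK _ _] [xs|xt]]; [exists s|exists t].
apply: bigcup_connected.
  by exists (unit_pt R v) => -[s t] [/= _ _ vt _]; right; exact: unit_pt_in.
move=> [s t] [/= _ _ _ /set0Pn[i]]; rewrite inE => /andP[is_ it].
apply: connectedU; [|exact: simplex_connected|exact: simplex_connected].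
by exists (unit_pt R i); split; exact: unit_pt_in.
Qed.

Variable C : {set I}.
Hypothesis C_uniq : forall s c d, s \in K -> c \in C -> d \in C -> c \in s -> d \in s -> c = d.

(* With C the set of face centres, the skeleton is the drawn graph. *)
Definition skeleton : set 'rV[R]_#|I| :=
  [set x | @polyhedron R I K x /\ forall c, c \in C -> coor x c = 0].

Lemma open_star_skeletonC c : c \in C -> open_star K c `<=` @polyhedron R I K `\` skeleton.
Proof. by move=> cC x [xK xc]; split => // -[_ /(_ _ cC) xc0]; rewrite xc0 ltxx in xc. Qed.

Lemma skeletonC_open_star x : (@polyhedron R I K `\` skeleton) x ->
  exists2 c, c \in C & open_star K c x.
Proof.
move=> [xK xS]; apply: contrapT => no; apply: xS; split => // c cC.
have [s sK [x0 _ _]] := xK; apply: contrapT => /eqP xc.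
by apply: no; exists c => //; split => //; rewrite lt_def xc x0.
Qed.

Lemma component_open_star c x : c \in C -> open_star K c x ->
  connected_component (@polyhedron R I K `\` skeleton) x = open_star K c.
Proof.
move=> cC xc; apply/seteqP; split; last first.
  by apply: connected_component_max => //; [exact: open_star_skeletonC|exact: open_star_connected].
have sub := @connected_component_sub _ (@polyhedron R I K `\` skeleton) x.
have Dx : (@polyhedron R I K `\` skeleton) x by exact: open_star_skeletonC xc.
set D := connected_component _ _ in sub *.
pose other (y : 'rV[R]_#|I|) : R := \sum_(d in C | d != c) coor y d.
have DE : D `&` [set y | 0 < coor y c] = D.
  apply: (@component_connected _ (@polyhedron R I K `\` skeleton) x).
  - by exists x; split; [exact: connected_component_refl|case: xc].
  - exists [set y | 0 < coor y c] => //.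
    exact: open_coor_gt0.
  exists (other @^-1` [set z | z <= 0]).
    apply: preimage_closed; last exact: closed_le.
    by move=> y _; exact: coor_sum_continuous.
  apply/seteqP; split => y [Dy yc]; split => //; have [[s sK ys] yS] := sub _ Dy.
    rewrite /other /= big1 // => d /andP[dC dc]; have [_ _ ->//] := ys.
    by apply: contra dc => ds; apply/eqP; apply: (C_uniq sK) => //; exact: coor_gt0_in yc.
  have [d dC [_ yd]] := skeletonC_open_star (sub _ Dy).
  have [<-//|dc] := eqVneq d c.
  suff : 0 < other y by rewrite ltNge yc.
  rewrite /other (bigD1 d) ?dC //= ltr_pwDl //.
  by apply: sumr_ge0 => e _; case: ys.
by rewrite -DE => y [/sub[yK _] yc].
Qed.

Lemma is_component_open_star (D : set 'rV[R]_#|I|) :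
  is_component (@polyhedron R I K `\` skeleton) D ->
  exists c s, [/\ c \in C, s \in K, c \in s & D = open_star K c].
Proof.
move=> [x xS ->]; have [c cC xc] := skeletonC_open_star xS.
have [[s sK xs] xc0] := xc.
by exists c, s; split => //; [exact: coor_gt0_in xc0|exact: component_open_star].
Qed.

End Components.

(** * The triangulation *)

Section Triangles.
Variables (F : finFieldType) (p : nat).
Hypothesis p_odd : odd p.
Hypothesis p_gt2 : (2 < p)%N.
Hypothesis natF_inj : forall i j, (i < p)%N -> (j < p)%N -> i%:R = j%:R :> F -> i = j.
Hypothesis natF_p : p%:R = 0 :> F.

(* u and v are consecutive on the face f, None being the point oo. For finite f
   the sums u + v of consecutive vertices alternate between 2 f and 2 f + 1, and
   oo is next to f + 1 and f + 1/2. *)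
Definition triangle (u v f : option F) : bool :=
  [&& u != v, u != f, v != f &
    match u, v, f with
    | Some a, Some b, Some c => (a + b == 2 * c) || (a + b == 2 * c + 1)
    | Some a, Some b, None => (a == b + 1) || (b == a + 1)
    | None, Some b, Some c | Some b, None, Some c => (b == c + 1) || (2 * b == 2 * c + 1)
    | _, _, _ => false
    end].

Lemma triangleC u v f : triangle u v f = triangle v u f.
Proof.
rewrite /triangle eq_sym; case: u => [a|]; case: v => [b|]; case: f => [c|] //=;
  rewrite ?(addrC b) //; case: (b != a) => //=; rewrite ?andbT ?andbF //.
- by rewrite !andbA [X in X && _]andbC.
- by rewrite orbC.
Qed.

Let two_neq0 : 2 != 0 :> F.
Proof.
by apply/negP => /eqP E; have := @natF_inj 2 0 p_gt2 (ltn_trans _ p_gt2); rewrite E => /(_ isT erefl).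
Qed.

Let h : F := 2^-1.
Let hE : 2 * h = 1. Proof. exact: divff. Qed.

Lemma half_uniq (x y : F) : 2 * x = y -> x = h * y.
Proof. by move=> <-; rewrite mulrA [h * 2]mulrC hE mul1r. Qed.

Lemma triangle_faces u v : exists f1 f2, forall f, triangle u v f -> f = f1 \/ f = f2.
Proof.
case: u => [a|]; case: v => [b|]; last by exists None, None.
- have [/orP ab|ab] := boolP ((a == b + 1) || (b == a + 1)).
    exists None, (Some (h * (a + b))) => -[c|]; last by left.
    move=> /and4P[_ ac bc /orP[]/eqP E]; right; congr Some.
      by rewrite E mulrA [h * 2]mulrC hE mul1r.
    exfalso; case: ab => /eqP abE.
      case/negP: bc; apply/eqP; congr Some; apply: (mulfI two_neq0).
      by apply: (@addIr _ 1); rewrite -E abE; ring.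
    case/negP: ac; apply/eqP; congr Some; apply: (mulfI two_neq0).
    by apply: (@addIr _ 1); rewrite -E abE; ring.
  exists (Some (h * (a + b))), (Some (h * (a + b - 1))) => -[c|]; last by rewrite /triangle (negbTE ab) !andbF.
  move=> /and4P[_ _ _ /orP[]/eqP E]; [left|right]; congr Some; apply: half_uniq.
    by rewrite E.
  by rewrite E addrK.
- exists (Some (a - 1)), (Some (a - h)) => -[c|]; last by rewrite /triangle !andbF.
  move=> /and4P[_ _ _ /orP[]/eqP E]; [left|right]; congr Some; first by rewrite E addrK.
  by apply: (mulfI two_neq0); rewrite mulrBr E hE addrK.
exists (Some (b - 1)), (Some (b - h)) => -[c|]; last by rewrite /triangle !andbF.
move=> /and4P[_ _ _ /orP[]/eqP E]; [left|right]; congr Some; first by rewrite E addrK.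
by apply: (mulfI two_neq0); rewrite mulrBr E hE addrK.
Qed.

Lemma triangle_nbrs v f : exists u1 u2, forall u, triangle v u f -> u = u1 \/ u = u2.
Proof.
case: v => [a|]; case: f => [c|]; last by exists None, None => -[b|]; rewrite /triangle !andbF.
- have [/orP ac|ac] := boolP ((a == c + 1) || (2 * a == 2 * c + 1)).
    exists None, (Some (2 * c - a)) => -[b|]; last by left.
    move=> /and4P[ab _ bc /orP[]/eqP E]; right; congr Some; first by rewrite -E addrAC subrr add0r.
    exfalso; case: ac => /eqP acE.
      by case/negP: bc; apply/eqP; congr Some; apply: (@addrI _ a); rewrite E acE; ring.
    by case/negP: ab; apply/eqP; congr Some; apply: (@addrI _ a); rewrite E -acE; ring.
  exists (Some (2 * c - a)), (Some (2 * c + 1 - a)) => -[b|]; last by rewrite /triangle (negbTE ac) !andbF.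
  by move=> /and4P[_ _ _ /orP[]/eqP E]; [left|right]; congr Some; rewrite -E addrAC subrr add0r.
- exists (Some (a - 1)), (Some (a + 1)) => -[b|]; last by rewrite /triangle !andbF.
  move=> /and4P[_ _ _ /orP[]/eqP E]; [left|right]; congr Some => //.
  by rewrite E addrK.
exists (Some (c + 1)), (Some (c + h)) => -[b|]; last by rewrite /triangle !andbF.
move=> /and4P[_ _ _ /orP[]/eqP E]; [left|right]; congr Some => //.
by apply: (mulfI two_neq0); rewrite mulrDr E hE.
Qed.

Lemma natF_eq0 i : (0 < i < p)%N -> i%:R != 0 :> F.
Proof.
move=> /andP[i0 ip]; apply/negP => /eqP iE.
by have := @natF_inj i 0 ip (ltn_trans i0 ip); rewrite iE => /(_ erefl) i0E; rewrite i0E in i0.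
Qed.

Lemma triangle_edge u v : u != v -> exists f, triangle u v f.
Proof.
case: u => [a|]; case: v => [b|] // uv.
- have ab : a != b by apply: contra uv => /eqP ->.
  exists (Some (h * (a + b))).
  have E : a + b = 2 * (h * (a + b)) by rewrite mulrA hE mul1r.
  apply/and4P; split => //; last by rewrite -E eqxx.
    apply: contra ab => /eqP[aE]; apply/eqP/esym/(@addrI _ a).
    by rewrite E -aE; ring.
  apply: contra ab => /eqP[bE]; apply/eqP/(@addIr _ b).
  by rewrite E -bE; ring.
- exists (Some (a - 1)); apply/and4P; split => //; last by rewrite subrK eqxx.
  by apply/negP => /eqP[] /eqP; rewrite -subr_eq0 opprB addrC subrK oner_eq0.
exists (Some (b - 1)); apply/and4P; split => //; last by rewrite subrK eqxx.
by apply/negP => /eqP[] /eqP; rewrite -subr_eq0 opprB addrC subrK oner_eq0.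
Qed.

Definition cyc_next (i : nat) : nat := if (i.+1 < p)%N then i.+1 else 0.

Lemma face_cycle f : exists u : nat -> option F,
  [/\ forall i j, (i < p)%N -> (j < p)%N -> u i = u j -> i = j,
      forall i, (i < p)%N -> u i != f &
      forall i, (i < p)%N -> triangle (u i) (u (cyc_next i)) f].
Proof.
case: f => [c|]; last first.
  exists (fun i => Some i%:R); split => //.
    by move=> i j ip jp []; exact: natF_inj.
  move=> i ip; rewrite /cyc_next; have [i1p|pi1] := ltnP i.+1 p.
    rewrite /triangle -natr1 eqxx orbT !andbT /=; apply/negP => /eqP[].
    by move/eqP; rewrite -subr_eq0 opprD addrA subrr sub0r oppr_eq0 oner_eq0.
  have iE : i.+1 = p by lia.
  rewrite /triangle /= (natr1 i) iE natF_p eqxx orbT !andbT.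
  by have := @natF_eq0 i; apply; lia.
pose k i := if odd i then i.+1./2 else (p - i./2)%N.
have kp i : (0 < i < p)%N -> (0 < k i < p)%N by rewrite /k; case: ifP; lia.
have k_inj i j : (0 < i < p)%N -> (0 < j < p)%N -> k i = k j -> i = j.
  by rewrite /k; case: ifP; case: ifP; lia.
pose u i := if i is 0 then None else Some (c + (k i)%:R).
have u_inj i j : (i < p)%N -> (j < p)%N -> u i = u j -> i = j.
  case: i j => [|i] [|j] //= ip jp [] /addrI E; apply: k_inj => //.
  by apply: natF_inj => //; [have /andP[] := kp i.+1 ip|have /andP[] := kp j.+1 jp].
have u_neq i : (i < p)%N -> u i != Some c.
  case: i => [|i] //= ip; apply/negP => /eqP[] /eqP; rewrite -subr_eq0 addrAC subrr add0r.
  by apply/negP; exact: natF_eq0 (kp i.+1 ip).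
exists u; split => // i ip; rewrite /cyc_next.
have u_neq2 j l : (j < p)%N -> (l < p)%N -> j != l -> u j != u l.
  by move=> jp lp; apply: contra => /eqP/u_inj ->.
apply/and4P; split; [by apply: u_neq2 => //; case: ifP; lia|exact: u_neq|by apply: u_neq; case: ifP; lia|].
have [i1p|pi1] := ltnP i.+1 p; last first.
  case: i ip pi1 => [|i] ip pi1; first by lia.
  rewrite /u /k /=; have -> : odd i = true by lia.
  rewrite /= mulrDr; apply/orP; right; apply/eqP; congr (_ + _).
  by rewrite -natrM (_ : (2 * (p - uphalf i) = p + 1)%N) ?natrD ?natF_p ?add0r //; lia.
case: i ip i1p => [|i] ip i1p; first by rewrite /= eqxx.
rewrite /u /k /=; have [io|ie] := boolP (odd i); apply/orP; [right|left]; apply/eqP.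
  rewrite addrACA -natrD (_ : (_ + _ = p + 1)%N) ?natrD ?natF_p; first by ring.
  lia.
rewrite addrACA -natrD (_ : (_ + _ = p)%N) ?natF_p; first by ring.
lia.
Qed.

Lemma vertex_cycle v : exists u g : nat -> option F,
  [/\ forall i j, (i < p)%N -> (j < p)%N -> u i = u j -> i = j,
      forall i j, (i < p)%N -> (j < p)%N -> g i = g j -> i = j,
      forall i, (i < p)%N -> u i != v /\ g i != v &
      forall i, (i < p)%N -> triangle v (u i) (g i) /\ triangle v (u (cyc_next i)) (g i)].
Proof.
have h0 : h != 0 by rewrite invr_neq0.
have p1 : p.-1%:R = -1 :> F.
  by apply/eqP; rewrite -subr_eq0 opprK natr1 prednK ?natF_p //; lia.
have p2 : p.-2%:R = -2 :> F.
  by apply/eqP; rewrite -subr_eq0 opprK -natrD (_ : (p.-2 + 2 = p)%N) ?natF_p //; lia.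
case: v => [a|]; last first.
  exists (fun i => Some (- (h * i%:R))), (fun i => Some (- (h * i%:R) - 1)); split => //.
  - by move=> i j ip jp [/oppr_inj/(mulfI h0)]; exact: natF_inj.
  - by move=> i j ip jp [/addIr/oppr_inj/(mulfI h0)]; exact: natF_inj.
  move=> i ip; have step (x : F) : x != 0 -> forall y, Some (y + x) != Some y.
    by move=> x0 y; apply: contra x0 => /eqP[/eqP]; rewrite -subr_eq0 addrAC subrr add0r.
  split; apply/and4P; split => //.
  - have -> : Some (- (h * i%:R)) = Some (- (h * i%:R) - 1 + 1) by rewrite subrK.
    exact: step (oner_neq0 _) _.
  - by rewrite subrK eqxx.
  - have -> : - (h * (cyc_next i)%:R) = - (h * i%:R) - 1 + h.
      have -> : (cyc_next i)%:R = i%:R + 1 :> F.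
        by rewrite /cyc_next natr1; case: ltnP => // pi; rewrite (_ : i.+1 = p) ?natF_p //; lia.
      by rewrite mulrDr mulr1 -[X in _ = _ - X + _]hE; ring.
    exact: step h0 _.
  - have -> : - (h * (cyc_next i)%:R) = - (h * i%:R) - 1 + h.
      have -> : (cyc_next i)%:R = i%:R + 1 :> F.
        by rewrite /cyc_next natr1; case: ltnP => // pi; rewrite (_ : i.+1 = p) ?natF_p //; lia.
      by rewrite mulrDr mulr1 -[X in _ = _ - X + _]hE; ring.
    by rewrite mulrDr hE eqxx orbT.
have step (x y : F) : x != y -> Some (a + x) != Some (a + y).
  by apply: contra => /eqP[/addrI ->].
have step0 (x : F) : x != 0 -> Some (a + x) != Some a.
  by move=> x0; have := step _ _ x0; rewrite addr0.
pose e i := if (i < p.-2)%N then i.+1 else p.-1.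
pose u i := if i == p.-2 then None else Some (a + (e i)%:R).
pose g i := if i == p.-1 then None else Some (a + h * i.+1%:R).
have e_in i : (0 < e i < p)%N by rewrite /e; case: ifP; lia.
have e_neq0 i : (e i)%:R != 0 :> F by exact: natF_eq0.
exists u, g; split.
- move=> i j ip jp; rewrite /u; case: (i =P p.-2) => ip2; case: (j =P p.-2) => jp2 //; first by lia.
  move=> [/addrI/natF_inj]; have := e_in i; have := e_in j.
  move=> /andP[_ ->] /andP[_ ->] /(_ isT isT); rewrite /e; case: ifP; case: ifP; lia.
- move=> i j ip jp; rewrite /g; case: (i =P p.-1) => ip2; case: (j =P p.-1) => jp2 //; first by lia.
  by move=> [/addrI/(mulfI h0)/natF_inj E]; apply/succn_inj/E; lia.
- move=> i ip; rewrite /u /g; split; first by case: (i =P p.-2) => // _; exact: step0 _ (e_neq0 i).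
  case: (i =P p.-1) => // iN.
  by apply: step0; rewrite mulf_neq0 // natF_eq0 //; lia.
have S0 i : (i.+1 < p)%N -> i.+1%:R != 0 :> F by move=> ip; apply: natF_eq0.
have neq_half (x y : F) : 2 * x - y != 0 -> x != h * y.
  by apply: contra => /eqP ->; rewrite mulrA hE mul1r subrr.
move=> i ip; rewrite /cyc_next; split.
- rewrite /u /g /e; have [iE|i2] := eqVneq i p.-2.
    have -> : (i == p.-1) = false by apply/negP => /eqP; lia.
    have iE1 : i.+1%:R = -1 :> F by rewrite -p1 iE; congr (_%:R); lia.
    rewrite iE1; apply/and4P; split => //.
      by rewrite eq_sym; apply: step0; rewrite mulrN1 oppr_eq0.
    by apply/orP; right; rewrite mulrDr mulrA hE; apply/eqP; ring.
  have [iE|i1] := eqVneq i p.-1.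
    have -> : (i < p.-2)%N = false by lia.
    rewrite p1; apply/and4P; split => //; last by rewrite subrK eqxx.
    by rewrite eq_sym; apply: step0; rewrite oppr_eq0 oner_neq0.
  have -> : (i < p.-2)%N by lia.
  have Si : i.+1%:R != 0 :> F by apply: S0; lia.
  apply/and4P; split.
  + by rewrite eq_sym step0.
  + by rewrite eq_sym step0 // mulf_neq0.
  + by apply: step; apply: neq_half; rewrite mulr_natl mulr2n addrK.
  by apply/orP; left; rewrite [2 * _]mulrDr mulrA hE; apply/eqP; ring.
have [i1p|pi1] := ltnP i.+1 p; last first.
  have -> : g i = None by rewrite /g; case: (i =P p.-1) => //; lia.
  have -> : u 0 = Some (a + 1).
    by rewrite /u /e; case: (0%N =P p.-2); [lia|]; case: ltnP => //; lia.
  apply/and4P; split => //; last by rewrite eqxx orbT.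
  by rewrite eq_sym step0 // oner_neq0.
have -> : g i = Some (a + h * i.+1%:R) by rewrite /g; case: (i =P p.-1) => //; lia.
have Si : i.+1%:R != 0 :> F by exact: S0.
have ag : Some a != Some (a + h * i.+1%:R) by rewrite eq_sym step0 // mulf_neq0.
rewrite /u /e; have [iE|i2] := eqVneq i.+1 p.-2.
  apply/and4P; split => //; apply/orP; left; rewrite iE p2 mulrN [h * 2]mulrC hE.
  by rewrite subrK.
have [i3|i3] := ltnP i.+1 p.-2.
  apply/and4P; split => //; first by rewrite eq_sym step0 // S0 //; lia.
    apply: step; apply: neq_half.
    have -> : 2 * i.+2%:R - i.+1%:R = i.+3%:R :> F by rewrite -![in RHS]natr1 -!natr1; ring.
    by apply: S0; lia.
  by apply/orP; right; rewrite [2 * _]mulrDr mulrA hE -[i.+2%:R]natr1; apply/eqP; ring.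
have iE : i.+1 = p.-1 by lia.
rewrite iE p1 in ag *; apply/and4P; split => //.
- by rewrite eq_sym step0 // oppr_eq0 oner_neq0.
- apply: step; apply: neq_half.
  by have -> : 2 * -1 - -1 = -1 :> F; [ring|rewrite oppr_eq0 oner_neq0].
by apply/orP; left; rewrite mulrN1 mulrBr hE; apply/eqP; ring.
Qed.

Hypothesis cardF : #|F| = p.

Lemma avoid_onto (u : nat -> option F) f :
  (forall i j, (i < p)%N -> (j < p)%N -> u i = u j -> i = j) ->
  (forall i, (i < p)%N -> u i != f) ->
  forall x, x != f -> exists2 i, (i < p)%N & x = u i.
Proof.
move=> u_inj u_neq x xf.
have uinj : injective (fun i : 'I_p => u i) by move=> i j /u_inj E; apply/val_inj/E.
have : [set u i | i : 'I_p]%SET = [set~ f]%SET.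
  apply/eqP; rewrite eqEcard cardsC1 card_option cardF card_imset // card_ord leqnn andbT.
  by apply/fintype.subsetP => _ /imsetP[i _ ->]; rewrite !inE u_neq.
move=> /setP/(_ x); rewrite !inE xf => /imsetP[i _ ->]; by exists i.
Qed.

End Triangles.

(** * Cyclic links *)

Section CyclicSequence.
Variables (T : finType) (m : nat) (u : nat -> T).
Hypothesis m_gt2 : (2 < m)%N.
Hypothesis u_inj : forall i j, (i < m)%N -> (j < m)%N -> u i = u j -> i = j.

Let prev (i : nat) : nat := if i is j.+1 then j else m.-1.

Let next_lt i : (cyc_next m i < m)%N.
Proof. by rewrite /cyc_next; case: ifP; lia. Qed.

Let prev_lt i : (i < m)%N -> (prev i < m)%N.
Proof. by rewrite /prev; case: i => [|i] /=; lia. Qed.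

Let prevK i : (i < m)%N -> cyc_next m (prev i) = i.
Proof. by rewrite /prev /cyc_next; case: i => [|i] /= im; case: ltnP; lia. Qed.

Let next_neq i : cyc_next m i != i.
Proof. by rewrite /cyc_next; case: ifP; lia. Qed.

Let next_prev_neq i : (i < m)%N -> cyc_next m i != prev i.
Proof. by rewrite /prev /cyc_next; case: i => [|i] /= im; case: ltnP; lia. Qed.

Let nextK i : (i < m)%N -> prev (cyc_next m i) = i.
Proof. by move=> im; rewrite /prev /cyc_next; case: ltnP => /=; lia. Qed.

(* In a complex where every edge at c lies in at most two triangles, a closed
   walk of the link of c through all its vertices is the whole link. *)
Lemma link_enum (K : {set {set T}}) (c : T) :
  (forall i, (i < m)%N -> [set c; u i; u (cyc_next m i)]%SET \in K) ->
  (forall i, (i < m)%N -> u i != c) ->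
  (forall s, s \in K -> c \in s ->
     exists x y, [/\ x != c, y != c, x != y & s = [set c; x; y]%SET]) ->
  (forall s x, s \in K -> c \in s -> x \in s -> x != c -> exists2 i, (i < m)%N & x = u i) ->
  (forall x, x != c -> exists y1 y2, forall y, y != x -> y != c ->
     [set c; x; y]%SET \in K -> y = y1 \/ y = y2) ->
  forall s, s \in K -> c \in s -> exists2 i, (i < m)%N & s = [set c; u i; u (cyc_next m i)]%SET.
Proof.
move=> uK uc K3 onto two s sK cs.
have [x [y [xc yc xy sE]]] := K3 s sK cs.
have [i im xE] : exists2 i, (i < m)%N & x = u i by apply: (onto s); rewrite // sE !inE eqxx ?orbT.
have [y1 [y2 y12]] := two x xc.
have nx : u (cyc_next m i) = y1 \/ u (cyc_next m i) = y2.
  apply: y12; [|exact: uc|by rewrite xE uK].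
  by rewrite xE; apply: contra (next_neq i) => /eqP/u_inj ->.
have px : u (prev i) = y1 \/ u (prev i) = y2.
  apply: y12; [|exact/uc/prev_lt|].
    rewrite xE; apply: contra (next_neq (prev i)) => /eqP/u_inj E.
    by rewrite prevK // -{1}E // prev_lt.
  rewrite xE -finset.setUA [X in (_ :|: X)%SET]finset.setUC finset.setUA -{2}(prevK im).
  by rewrite uK // prev_lt.
have np : u (cyc_next m i) != u (prev i).
  by apply: contra (next_prev_neq im) => /eqP/u_inj -> //; exact: prev_lt.
have [yE|yE] : y = u (cyc_next m i) \/ y = u (prev i).
- have := y12 y; rewrite eq_sym xy -sE => /(_ isT yc sK).
  move: nx px np; case=> ->; case=> ->; rewrite ?eqxx // => _ [->|->];
    first [by left|by right].
- by exists i => //; rewrite sE xE yE.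
exists (prev i); first exact: prev_lt.
by rewrite prevK // sE xE yE -!finset.setUA [X in (_ :|: X)%SET]finset.setUC.
Qed.

Let edge i : {set T} := [set u i; u (cyc_next m i)]%SET.

Let edge_inj : injective (fun i : 'I_m => edge i).
Proof.
move=> i j eij; apply/val_inj => /=.
have : u i \in edge j by rewrite -[edge j]eij !inE eqxx.
rewrite !inE => /orP[/eqP/u_inj->//|/eqP/u_inj iE].
have : u (cyc_next m i) \in edge j by rewrite -[edge j]eij !inE eqxx orbT.
rewrite !inE => /orP[/eqP/u_inj jE|/eqP/u_inj jE].
  have := next_prev_neq (ltn_ord i).
  by rewrite jE // iE // nextK // eqxx.
by have := next_neq i; rewrite jE // -iE // eqxx.
Qed.

Definition cycle_edges : {set {set T}} := [set edge i | i : 'I_m]%SET.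

Lemma card_cycle_edges : #|cycle_edges| = m.
Proof. by rewrite card_imset // card_ord. Qed.

Lemma cycle_edges_is_cycle : is_cycle [set u i | i : 'I_m]%SET cycle_edges.
Proof.
have m0 : (0 < m)%N by lia.
have edgeP i : (i < m)%N -> edge i \in cycle_edges.
  by move=> im; apply/imsetP; exists (Ordinal im).
have uW i : (i < m)%N -> u i \in [set u i | i : 'I_m]%SET.
  by move=> im; apply/imsetP; exists (Ordinal im).
split.
- by apply/set0Pn; exists (u 0); exact: uW.
- move=> _ /imsetP[i _ ->]; apply/fintype.subsetP => x.
  by rewrite !inE => /orP[]/eqP->; exact: uW.
- move=> _ /imsetP[j _ ->].
  have -> : [set b in cycle_edges | u j \in b]%SET = [set edge j; edge (prev j)]%SET.
    apply/setP => b; rewrite !inE; apply/andP/orP.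
      move=> [/imsetP[i _ ->]]; rewrite !inE => /orP[]/eqP/u_inj jE; first by left; rewrite jE.
      by right; rewrite jE // nextK.
    move=> [/eqP->|/eqP->]; split; rewrite ?edgeP ?prev_lt // !inE ?eqxx // prevK ?eqxx ?orbT //.
  rewrite cards2; case: eqP => // E.
  have := @edge_inj j (Ordinal (prev_lt (ltn_ord j))) E => /(congr1 val) /= jE.
  by have := next_neq (prev j); rewrite prevK // -jE eqxx.
have sym : connect_sym (fun x y : T => [set x; y]%SET \in cycle_edges).
  by apply: sym_connect_sym => x y; rewrite finset.setUC.
have con i : (i < m)%N -> connect (fun x y : T => [set x; y]%SET \in cycle_edges) (u 0) (u i).
  elim: i => [|i IHi] im; first exact: connect0.
  apply: connect_trans (IHi (ltnW im)) (connect1 _).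
  by have := edgeP i (ltnW im); rewrite /edge /cyc_next im.
move=> _ _ /imsetP[i _ ->] /imsetP[j _ ->].
by apply: connect_trans (con j _) => //; rewrite sym con.
Qed.

End CyclicSequence.

Lemma next_rayE m i : (1 < m)%N -> next_ray m.-2 i = cyc_next m i.
Proof.
by move=> m1; rewrite /next_ray /cyc_next; case: (leqP i m.-2); case: (ltnP i.+1 m) => //; lia.
Qed.

Lemma cyclic_link_chart (R : realType) (I : finType) (K : {set {set I}}) (c : I)
    (m : nat) (w : nat -> I) :
  (2 < m)%N ->
  (forall i j, (i < m)%N -> (j < m)%N -> w i = w j -> i = j) ->
  (forall i, (i < m)%N -> w i != c) ->
  (forall i, (i < m)%N -> [set c; w i; w (cyc_next m i)]%SET \in K) ->
  (forall s, s \in K -> c \in s ->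
     exists2 i, (i < m)%N & s = [set c; w i; w (cyc_next m i)]%SET) ->
  exists (U : set 'rV[R]_#|I|) (V : set 'rV[R]_2),
    [/\ open U, (forall x, 0 < coor x c -> U x), open V & homeomorphic (polyhedron K `&` U) V].
Proof.
move=> m2 w_inj w_neq wK starE.
have le_lt i : (i <= m.-2.+1)%N = (i < m)%N by apply/idP/idP; lia.
apply: (@open_star_chart R I K c m.-2 w); first lia.
- by move=> i j; rewrite !le_lt; exact: w_inj.
- by move=> i; rewrite le_lt; exact: w_neq.
- by move=> i; rewrite le_lt next_rayE ?(ltnW m2) //; exact: wK.
move=> s sK cs; have [i im sE] := starE s sK cs.
by exists i; rewrite ?le_lt // next_rayE // ltnW.
Qed.

(** * The pattern *)

Section Pattern.
Variables (R : realType) (F : finFieldType) (p : nat).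
Hypothesis p_odd : odd p.
Hypothesis p_gt2 : (2 < p)%N.
Hypothesis cardF : #|F| = p.
Hypothesis natF_inj : forall i j, (i < p)%N -> (j < p)%N -> i%:R = j%:R :> F -> i = j.
Hypothesis natF_p : p%:R = 0 :> F.

Let V : finType := option F.
Let node : finType := (V + V)%type.

Definition triangle_set (t : V * V * V) : {set node} :=
  [set inl t.1.1; inl t.1.2; inr t.2]%SET.

Definition complex : {set {set node}} :=
  [set triangle_set t | t in [set t : V * V * V | triangle t.1.1 t.1.2 t.2]%SET]%SET.

Lemma triangle_neq (u v f : V) : triangle u v f -> [/\ u != v, u != f & v != f].
Proof. by case/and4P. Qed.

Lemma complexP s : reflect (exists u v f, triangle u v f /\ s = [set inl u; inl v; inr f]%SET)
  (s \in complex).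
Proof.
apply: (iffP imsetP) => [[[[u v] f]]|[u [v [f [uvf ->]]]]].
  by rewrite inE /= => uvf ->; exists u, v, f.
by exists (u, v, f) => //; rewrite inE.
Qed.

Lemma complex_inl s (a b f : V) : s \in complex -> inl a \in s -> inl b \in s -> inr f \in s ->
  a != b -> triangle a b f.
Proof.
move=> /complexP[u [v [g [uvg ->]]]]; rewrite !inE /= !orbF => ua ub fg.
have -> : f = g by apply/eqP.
by case/orP: ua => /eqP[->]; case/orP: ub => /eqP[->]; rewrite ?eqxx // triangleC.
Qed.

Lemma complex_inr s (f g : V) : s \in complex -> inr f \in s -> inr g \in s -> f = g.
Proof.
by move=> /complexP[u [v [e [_ ->]]]]; rewrite !inE /= => /eqP[->] /eqP[->].
Qed.

Lemma complex_inr_ex s : s \in complex -> exists f, inr f \in s.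
Proof. by move=> /complexP[u [v [f [_ ->]]]]; exists f; rewrite !inE eqxx orbT. Qed.

Lemma complex_neq s (a f : V) : s \in complex -> inl a \in s -> inr f \in s -> a != f.
Proof.
move=> /complexP[u [v [g [/triangle_neq[_ ug vg] ->]]]]; rewrite !inE /= !orbF.
by move=> /orP[]/eqP[->] /eqP[->].
Qed.

Lemma setAC3 (T : finType) (a b c : T) :
  [set a; b; c]%SET = [set c; a; b]%SET /\ [set a; b; c]%SET = [set a; c; b]%SET.
Proof.
split; apply/setP => x; rewrite !inE.
  by rewrite orbC orbA.
by rewrite -!orbA [X in _ || X]orbC.
Qed.

Lemma face_link f : exists u : nat -> V,
  [/\ forall i j, (i < p)%N -> (j < p)%N -> u i = u j -> i = j,
      forall i, (i < p)%N -> u i != f,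
      forall x, x != f -> exists2 i, (i < p)%N & x = u i,
      forall i, (i < p)%N -> triangle (u i) (u (cyc_next p i)) f &
      forall a b, triangle a b f ->
        exists2 i, (i < p)%N & [set a; b]%SET = [set u i; u (cyc_next p i)]%SET].
Proof.
have [u [u_inj u_neq u_tri]] := face_cycle p_odd p_gt2 natF_inj natF_p f.
have onto := avoid_onto cardF u_inj u_neq.
exists u; split => // a b abf.
have starE : forall s, s \in complex -> inr f \in s -> exists2 i, (i < p)%N &
    s = [set inr f; inl (u i); inl (u (cyc_next p i))]%SET.
  apply: (@link_enum _ _ (fun i => inl (u i)) p_gt2) => //.
  - by move=> i j ip jp [] /u_inj; exact.
  - move=> i ip; apply/complexP; exists (u i), (u (cyc_next p i)), f.
    by rewrite u_tri // (setAC3 (inl (u i)) _ _).1.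
  - move=> s /complexP[x [y [g [/triangle_neq[xy _ _] ->]]]].
    rewrite !inE /= => /eqP[->]; exists (inl x), (inl y); split => //.
    exact: (setAC3 _ _ _).1.
  - move=> s [x|g] sK fs xs xf; last by rewrite (complex_inr sK fs xs) eqxx in xf.
    by have [i ip ->] := onto x (complex_neq sK xs fs); exists i.
  move=> [x|g] xf; last first.
    exists (inr g), (inr g) => y yg yf sK.
    by rewrite (@complex_inr _ g f sK) ?inE ?eqxx ?orbT // in xf.
  have [u1 [u2 u12]] := triangle_nbrs p_gt2 natF_inj x f.
  exists (inl u1), (inl u2) => -[y|g] yx yf sK.
    have /u12 : triangle x y f.
      by apply: (complex_inl sK); rewrite ?inE ?eqxx ?orbT // eq_sym.
    by case=> ->; [left|right].
  by rewrite (@complex_inr _ g f sK) ?inE ?eqxx ?orbT // in yf.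
have sK : [set inl a; inl b; inr f]%SET \in complex by apply/complexP; exists a, b, f.
have [|i ip /setP E] := starE _ sK; first by rewrite !inE eqxx orbT.
exists i => //; apply/setP => x; have := E (inl x).
by rewrite !inE /= !orbF.
Qed.

Lemma vertex_link v : exists w : nat -> node,
  [/\ forall i j, (i < 2 * p)%N -> (j < 2 * p)%N -> w i = w j -> i = j,
      forall i, (i < 2 * p)%N -> w i != inl v,
      forall i, (i < 2 * p)%N -> [set inl v; w i; w (cyc_next (2 * p) i)]%SET \in complex &
      forall s, s \in complex -> inl v \in s ->
        exists2 i, (i < 2 * p)%N & s = [set inl v; w i; w (cyc_next (2 * p) i)]%SET].
Proof.
have [u [g [u_inj g_inj ug_neq ug_tri]]] := vertex_cycle p_odd p_gt2 natF_inj natF_p v.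
have u_onto := avoid_onto cardF u_inj (fun i ip => (ug_neq i ip).1).
have g_onto := avoid_onto cardF g_inj (fun i ip => (ug_neq i ip).2).
pose w i : node := if odd i then inr (g i./2) else inl (u i./2).
have half_lt i : (i < 2 * p)%N -> (i./2 < p)%N by lia.
have w_inj i j : (i < 2 * p)%N -> (j < 2 * p)%N -> w i = w j -> i = j.
  move=> /half_lt ip /half_lt jp; rewrite /w.
  by case: ifP => io; case: ifP => jo // - []; first [move=> /g_inj E|move=> /u_inj E];
    have := E ip jp; lia.
have w_neq i : (i < 2 * p)%N -> w i != inl v.
  by move=> /half_lt ip; rewrite /w; case: ifP => // _; have [+ _] := ug_neq _ ip.
have wK i : (i < 2 * p)%N -> [set inl v; w i; w (cyc_next (2 * p) i)]%SET \in complex.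
  move=> ip; have [t1 t2] := ug_tri _ (half_lt i ip).
  have [io|ie] := boolP (odd i).
    have -> : w i = inr (g i./2) by rewrite /w io.
    have -> : w (cyc_next (2 * p) i) = inl (u (cyc_next p i./2)).
      rewrite /w /cyc_next; case: (ltnP i.+1 (2 * p)) => h1; case: (ltnP i./2.+1 p) => h2 //=; try lia.
      rewrite io /=; congr (inl (u _)); lia.
    apply/complexP; exists v, (u (cyc_next p i./2)), (g i./2).
    by rewrite t2 (setAC3 (inl v) _ _).2.
  have -> : w i = inl (u i./2) by rewrite /w (negbTE ie).
  have -> : w (cyc_next (2 * p) i) = inr (g i./2).
    rewrite /w /cyc_next; case: (ltnP i.+1 (2 * p)) => h1; last lia.
    rewrite /= ie; congr (inr (g _)); lia.
  by apply/complexP; exists v, (u i./2), (g i./2).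
exists w; split => //.
apply: link_enum => //; first lia.
- move=> s /complexP[x [y [f [/triangle_neq[xy _ _] ->]]]].
  rewrite !inE /= !orbF => /orP[]/eqP[->].
    by exists (inl y), (inr f); rewrite eq_sym xy.
  exists (inl x), (inr f); split => //; apply/setP => z; rewrite !inE.
  by rewrite [X in X || _]orbC.
- move=> s [x|f] sK vs xs xv.
    have [i ip ->] := u_onto x xv; exists i.*2; first lia.
    by rewrite /w odd_double doubleK.
  have [|i ip ->] := g_onto f; first by rewrite eq_sym (complex_neq sK vs xs).
  exists i.*2.+1; first lia.
  by rewrite /w /= odd_double /= uphalf_double.
move=> [x|f] xv.
  have [f1 [f2 f12]] := triangle_faces p_gt2 natF_inj v x.
  exists (inr f1), (inr f2) => -[y|f] yx yv sK.
    have [f] := complex_inr_ex sK; by rewrite !inE.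
  have /f12 : triangle v x f.
    by apply: (complex_inl sK); rewrite ?inE ?eqxx ?orbT // eq_sym.
  by case=> ->; [left|right].
have [u1 [u2 u12]] := triangle_nbrs p_gt2 natF_inj v f.
exists (inl u1), (inl u2) => -[y|g'] yf yv sK.
  have /u12 : triangle v y f.
    by apply: (complex_inl sK); rewrite ?inE ?eqxx ?orbT // eq_sym.
  by case=> ->; [left|right].
by rewrite (@complex_inr _ f g' sK) ?inE ?eqxx ?orbT // in yf.
Qed.

Let surface : set 'rV[R]_#|node| := polyhedron complex.

Lemma surface_chart (c : node) : exists (U : set 'rV[R]_#|node|) (W : set 'rV[R]_2),
  [/\ open U, (forall x, 0 < coor x c -> U x), open W & homeomorphic (surface `&` U) W].
Proof.
case: c => [v|f].
  have [w [w_inj w_neq wK starE]] := vertex_link v.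
  have m2 : (2 < 2 * p)%N by lia.
  exact: (@cyclic_link_chart R node complex (inl v) (2 * p) w m2 w_inj w_neq wK starE).
have [u [u_inj u_neq u_onto u_tri u_edge]] := face_link f.
apply: (@cyclic_link_chart R node complex (inr f) p (fun i => inl (u i))) => //.
- by move=> i j ip jp [] /u_inj; exact.
- move=> i ip; apply/complexP; exists (u i), (u (cyc_next p i)), f.
  by rewrite u_tri // (setAC3 (inl (u i)) _ _).1.
move=> s /complexP[a [b [g [abg ->]]]]; rewrite !inE /= => /eqP[fg].
rewrite -fg in abg *; have [i ip /setP E] := u_edge a b abg.
exists i => //; apply/setP => -[x|e]; rewrite !inE /= ?orbF //.
by have := E x; rewrite !inE.
Qed.

Lemma vertex_in_complex (v : V) : exists f s,
  [/\ s \in complex, inl v \in s, inl None \in s & inr f \in s].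
Proof.
have [v' [vv' oo]] : exists v', v != v' /\ (v = None \/ v' = None).
  by case: v => [a|]; [exists None; split; [|right]|exists (Some 0); split; [|left]].
have [f vf] := triangle_edge p_gt2 natF_inj vv'.
exists f, [set inl v; inl v'; inr f]%SET; split; rewrite ?inE ?eqxx ?orbT //.
  by apply/complexP; exists v, v', f.
by case: oo => ->; rewrite ?eqxx ?orbT.
Qed.

Lemma surface_closed_surface : connected_closed_surface surface.
Proof.
split.
- have [f [s [sK vs _ _]]] := vertex_in_complex None.
  by exists (unit_pt R (inl None : node)), s => //; exact: unit_pt_in.
- exact: polyhedron_compact.
- apply: (@polyhedron_connected _ _ _ (inl None)) => s /complexP[u [v [f [_ ->]]]].
  have [_ [t [tK ut oot _]]] := vertex_in_complex u.
  by exists (inl u), t; rewrite !inE eqxx.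
move=> x [s sK xs]; have [c _ xc] := simplex_neq0 xs.
by have [U [W [oU cU oW h]]] := surface_chart c; exists U, W; split => //; exact: cU.
Qed.

Definition complete_graph (T : finType) : sgraph.
Proof.
refine (@SGraph T (fun u v => u != v) _ _).
  by move=> u v; rewrite eq_sym.
by move=> u; rewrite eqxx.
Defined.

Lemma complete_edgesP (T : finType) (a : {set complete_graph T}) :
  reflect (exists u v : T, u != v /\ a = [set u; v]%SET) (a \in edges (complete_graph T)).
Proof.
apply: (iffP imsetP) => [[[u v]]|[u [v [uv ->]]]].
  by rewrite inE /= => uv ->; exists u, v.
by exists (u, v); rewrite ?inE.
Qed.

Let pos (v : complete_graph V) : 'rV[R]_#|node| := unit_pt R (inl v : node).

Let arc (a : {set complete_graph V}) : set 'rV[R]_#|node| := @simplex R node (inl @: a)%SET.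

Let inl_inj : injective (inl : V -> node). Proof. by move=> x y []. Qed.

Lemma unit_pt_inP (s : {set node}) i : simplex s (unit_pt R i) <-> i \in s.
Proof.
split => [h|]; last exact: unit_pt_in.
by apply: (coor_gt0_in h); rewrite coor_unit_pt eqxx.
Qed.

Lemma arc_edge (u v : V) : arc [set u; v]%SET = simplex [set inl u; inl v]%SET.
Proof. by rewrite /arc imsetU1 imset_set1. Qed.

Lemma surface_embedded : embedded_in surface pos arc.
Proof.
split.
- move=> u v /(congr1 (fun x => coor x (inl u : node))); rewrite !coor_unit_pt eqxx.
  by case: eqP => [[->]//|_] /eqP; rewrite oner_eq0.
- move=> v; have [f [s [sK vs _ _]]] := vertex_in_complex v.
  by exists s => //; exact: unit_pt_in.
- move=> a /complete_edgesP[u [v [uv ->]]] x; rewrite arc_edge => xs.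
  have [f uvf] := triangle_edge p_gt2 natF_inj uv.
  exists [set inl u; inl v; inr f]%SET; first by apply/complexP; exists u, v, f.
  by apply: simplexS xs; exact: finset.subsetUl.
- by move=> u v uv; rewrite arc_edge; exact: arc_simplex2.
split=> [a v _ /unit_pt_inP|a b]; first by rewrite mem_imset.
move=> /complete_edgesP[u [v [uv aE]]] /complete_edgesP[u' [v' [uv' bE]]] ab x xa xb.
have xab : @simplex R node (inl @: (a :&: b))%SET x.
  by rewrite imsetI; [exact: simplexI|move=> ? ? _ _; exact: inl_inj].
have [i iab _] := simplex_neq0 xab; case/imsetP: iab => y; rewrite inE => /andP[ya yb] iE.
exists y; split => //; suff yE : (a :&: b)%SET = [set y]%SET.
  by apply: simplex1; rewrite yE imset_set1 in xab.
apply/eqP; rewrite eq_sym eqEcard finset.sub1set inE ya yb cards1 /=.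
have ca : #|a| = 2%N by rewrite aE cards2 uv.
have cb : #|b| = 2%N by rewrite bE cards2 uv'.
rewrite leqNgt; apply: contra ab => c2.
have ia : (a :&: b)%SET = a by apply/eqP; rewrite eqEcard finset.subsetIl ca.
have ib : (a :&: b)%SET = b by apply/eqP; rewrite eqEcard finset.subsetIr cb.
by rewrite -{1}ia ib.
Qed.

Let centres : {set node} := [set inr f | f : V]%SET.

Let centres_uniq s c d : s \in complex -> c \in centres -> d \in centres ->
  c \in s -> d \in s -> c = d.
Proof.
by move=> sK /imsetP[f _ ->] /imsetP[g _ ->] fs gs; rewrite (complex_inr sK fs gs).
Qed.

Lemma drawingE : drawing pos arc = skeleton complex centres.
Proof.
apply/seteqP; split => x.
  have vert v : skeleton complex centres (pos v).
    split; first by have [_ vs _ _ _] := surface_embedded; exact: vs.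
    by move=> _ /imsetP[f _ ->]; rewrite coor_unit_pt.
  move=> [[v ->]//|[a aE xa]]; split.
    by have [_ _ asub _ _] := surface_embedded; exact: asub xa.
  move=> _ /imsetP[f _ ->]; have [_ _ ->//] := xa.
  by apply/imsetP => -[].
move=> [[s /complexP[u [v [f [uvf ->]]]] xs] xc]; right.
have [uv _ _] := triangle_neq uvf.
exists [set u; v]%SET; first by apply/complete_edgesP; exists u, v.
rewrite arc_edge; have [x0 x1 xout] := xs; split => // i.
rewrite !inE negb_or => /andP[iu iv]; have [->|iF] := eqVneq i (inr f).
  by apply: xc; exact: imset_f.
by apply: xout; rewrite !inE !negb_or iu iv.
Qed.

Lemma component_simply_connected C :
  is_component (surface `\` drawing pos arc) C -> simply_connected R C.
Proof.
rewrite drawingE => /(is_component_open_star centres_uniq)[c [s [_ sK cs ->]]].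
exact: open_star_simply_connected sK cs.
Qed.

Definition complete_pattern : pattern R :=
  Pattern surface_closed_surface surface_embedded component_simply_connected.

Lemma face_closed_star (D : set 'rV[R]_#|node|) : is_face (P := complete_pattern) D ->
  exists f, D = closed_star complex (inr f).
Proof.
move=> [C]; rewrite /= drawingE.
move=> /(is_component_open_star centres_uniq)[c [s [/imsetP[f _ ->] sK cs ->]]] ->.
by exists f; rewrite closure_open_star.
Qed.

Lemma arc_in_closed_star (a b f : V) : a != b ->
  arc [set a; b]%SET `<=` closed_star complex (inr f) <-> triangle a b f.
Proof.
move=> ab; rewrite arc_edge; split => [sub|abf x xs]; last first.
  exists [set inl a; inl b; inr f]%SET; split.
  - by apply/complexP; exists a, b, f.
  - by rewrite !inE eqxx orbT.
  by apply: simplexS xs; exact: finset.subsetUl.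
pose m : 'rV[R]_#|node| := unit_pt R (inl a) + 2^-1 *: (unit_pt R (inl b) - unit_pt R (inl a)).
have h01 : 0 <= (2^-1 : R) <= 1 by lra.
have [|s [sK fs ms]] := sub m.
  by apply: simplex_convex => //; apply: unit_pt_in; rewrite !inE eqxx ?orbT.
have nab : (inl a == inl b :> node) = false by apply: contraNF ab => /eqP[->].
apply: (complex_inl sK) => //; apply: (coor_gt0_in ms).
  by rewrite coor_segment !coor_unit_pt eqxx nab /=; lra.
by rewrite coor_segment !coor_unit_pt eqxx eq_sym nab /=; lra.
Qed.

Lemma face_cycleE (D : set 'rV[R]_#|node|) : is_face (P := complete_pattern) D ->
  exists u : nat -> V,
    [/\ forall i j, (i < p)%N -> (j < p)%N -> u i = u j -> i = j,
        face_verts (P := complete_pattern) D = [set u i | i : 'I_p]%SET &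
        face_edges (P := complete_pattern) D = cycle_edges p u].
Proof.
move=> /face_closed_star[f ->]; have [u [u_inj u_neq u_onto u_tri u_edge]] := face_link f.
exists u; split => //.
  apply/setP => v; rewrite !inE; apply/asboolP/imsetP.
    move=> [s [sK fs /unit_pt_inP vs]].
    have [i ip ->] := u_onto v (complex_neq sK vs fs).
    by exists (Ordinal ip).
  move=> [[i ip] _ ->]; exists [set inl (u i); inl (u (cyc_next p i)); inr f]%SET; split.
  - by apply/complexP; exists (u i), (u (cyc_next p i)), f; rewrite u_tri.
  - by rewrite !inE eqxx orbT.
  by apply/unit_pt_inP; rewrite !inE eqxx.
apply/setP => a; rewrite !inE; apply/andP/imsetP.
  move=> [/complete_edgesP[x [y [xy ->]]] /asboolP /(arc_in_closed_star _ xy) /u_edge[i ip ->]].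
  by exists (Ordinal ip).
move=> [[i ip] _ ->] /=; have := u_tri i ip => t; have [uv _ _] := triangle_neq t.
split; first by apply/complete_edgesP; exists (u i), (u (cyc_next p i)).
by apply/asboolP/arc_in_closed_star.
Qed.

Lemma complete_patternP :
  [/\ non_singular complete_pattern, is_pq_pattern complete_pattern p p &
      #|pgraph complete_pattern| = p.+1].
Proof.
have cardV : #|V| = p.+1 by rewrite card_option cardF.
split; last exact: cardV.
  move=> D /face_cycleE[u [u_inj -> ->]].
  exact: cycle_edges_is_cycle.
split => [D /face_cycleE[u [u_inj _ ->]]|v]; first exact: card_cycle_edges.
rewrite /degree /=; have -> : [set w | v != w]%SET = [set~ v]%SET.
  by apply/setP => w; rewrite !inE eq_sym.
by rewrite cardsC1 cardV.
Qed.

End Pattern.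

Theorem theorem2 (R : realType) (p : nat) (hp : prime p) (hodd : odd p) :
  exists P : pattern R,
    [/\ non_singular P, is_pq_pattern P p p & #|pgraph P| = p.+1].
Proof.
have p2 : (2 < p)%N by have := prime_gt1 hp; case: p hodd {hp} => [|[|[|]]].
have natFE i : (i < p)%N -> nat_of_ord (i%:R : 'F_p) = i.
  by move=> ip; rewrite val_Fp_nat // modn_small.
have inj i j : (i < p)%N -> (j < p)%N -> i%:R = j%:R :> 'F_p -> i = j.
  by move=> /natFE iE /natFE jE E; rewrite -iE -jE E.
have p0 : p%:R = 0 :> 'F_p by exact: pchar_Fp_0.
exists (complete_pattern R hodd p2 (card_Fp hp) inj p0).
exact: complete_patternP.
Qed.
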